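(* Let $F$ be a field of characteristic zero and let $L=L_0\oplus L_1$ be a finite dimensional simple Lie superalgebra over $F$, with $d=\dim L$. Then the graded PI-exponent $$exp^{gr}(L)=\lim_{n\to\infty}\sqrt[n]{c_n^{gr}(L)}$$ exists and is less than or equal to $d=\dim L$, where $c_n^{gr}(L)$ denotes the total graded $n$th codimension of $L$.
   Context: Let $L=L_0\oplus L_1$ be a Lie superalgebra over a field $F$ of characteristic zero; elements of $L_0$ are called even and elements of $L_1$ odd. ''Simple'' is in the usual sense for Lie superalgebras: $[L,L]\neq 0$ and $L$ has no graded ideals other than $0$ and $L$. Let $\mathcal{L}(X,Y)$ be the free Lie superalgebra over $F$ with an infinite set $X=\{x_1,x_2,\ldots\}$ of even generators and an infinite set $Y=\{y_1,y_2,\ldots\}$ of odd generators. A polynomial $f=f(x_1,\ldots,x_m,y_1,\ldots,y_n)\in\mathcal{L}(X,Y)$ is a graded identity of $L$ if $f(a_1,\ldots,a_m,b_1,\ldots,b_n)=0$ for all $a_1,\ldots,a_m\in L_0$ and $b_1,\ldots,b_n\in L_1$. The set of all graded identities of $L$ is denoted $Id^{gr}(L)$; it is an ideal of $\mathcal{L}(X,Y)$. For integers $0\le k\le n$, let $P_{k,n-k}\subseteq\mathcal{L}(X,Y)$ be the subspace of all multilinear polynomials in $x_1,\ldots,x_k,y_1,\ldots,y_{n-k}$ (each of these variables occurring exactly once in every monomial), and set $$P_{k,n-k}(L)=\frac{P_{k,n-k}}{P_{k,n-k}\cap Id^{gr}(L)},\qquad c_{k,n-k}(L)=\dim P_{k,n-k}(L).$$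 The total graded $n$th codimension of $L$ is $$c_n^{gr}(L)=\sum_{k=0}^n\binom{n}{k}c_{k,n-k}(L).$$ *)

(* Defs.v *)
From HB Require Import structures.
From mathcomp Require Import all_boot all_order all_algebra generic_quotient.
From mathcomp Require Import boolp classical_sets reals topology normedtype.
From mathcomp Require Import sequences exp.

Set Implicit Arguments.
Unset Strict Implicit.
Unset Printing Implicit Defensive.
Import Order.TTheory GRing.Theory Num.Theory.
Import numFieldNormedType.Exports.

Local Open Scope classical_set_scope.
Local Open Scope quotient_scope.
Local Open Scope ring_scope.

(* In the parity index, false is even, true is odd, and (+) is addition mod 2.
   These axioms are the right ones when 2 and 3 are invertible in F. *)
HB.mixin Record isLieSuperalgebra (F : fieldType) L of GRing.Lmodule F L := {
  part : bool -> set L;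
  bracket : L -> L -> L;
  part0 : forall i, part i 0;
  partZD : forall i (a : F) u v, part i u -> part i v -> part i (a *: u + v);
  part_direct : forall u, part false u -> part true u -> u = 0;
  part_decomp : forall u,
    exists u0 u1, [/\ part false u0, part true u1 & u = u0 + u1];
  bracketZDl : forall (a : F) u v w,
    bracket (a *: u + v) w = a *: bracket u w + bracket v w;
  bracketZDr : forall (a : F) u v w,
    bracket w (a *: u + v) = a *: bracket w u + bracket w v;
  bracket_part : forall i j u v,
    part i u -> part j v -> part (i (+) j) (bracket u v);
  bracket_skew : forall i j u v, part i u -> part j v ->
    bracket u v = - ((-1) ^+ (i && j) *: bracket v u);
  bracket_jacobi : forall i j u v w, part i u -> part j v ->
    bracket u (bracket v w) =
      bracket (bracket u v) w + (-1) ^+ (i && j) *: bracket v (bracket u w)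
}.

#[short(type="lieSuperalgType")]
HB.structure Definition LieSuperalgebra (F : fieldType) :=
  {L of GRing.Lmodule F L & isLieSuperalgebra F L}.

#[short(type="finLieSuperalgType")]
HB.structure Definition FinLieSuperalgebra (F : fieldType) :=
  {L of Vector F L & isLieSuperalgebra F L}.

Section Submodules.
Variables (F : fieldType) (M : lmodType F).
Implicit Types (A V W : set M).

Definition is_submodule V :=
  V 0 /\ forall (a : F) u v, V u -> V v -> V (a *: u + v).

Definition lspan A : set M :=
  [set v | exists n (c : 'I_n -> F) (e : 'I_n -> M),
     (forall i, A (e i)) /\ v = \sum_i c i *: e i].

(* e is a family in V whose classes form a basis of V / W, for W contained
   in V. *)
Definition quot_basis V W n (e : 'I_n -> M) :=
  (forall i, V (e i)) /\
  (forall v, V v -> exists! c : 'rV[F]_n, W (v - \sum_i c 0 i *: e i)).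

Definition has_quot_dim V W n := exists e : 'I_n -> M, quot_basis V W e.

(* dim (V / W); the value is 0 if V / W is infinite dimensional. *)
Definition quot_dim V W : nat := xget 0%N [set n | has_quot_dim V W n].

End Submodules.

Section Simple.
Variables (F : fieldType) (L : lieSuperalgType F).

Definition graded_ideal (I : set L) :=
  [/\ is_submodule I,
      forall u v, I u -> I (bracket u v) /\ I (bracket v u) &
      forall u, I u -> exists u0 u1,
        [/\ I u0, I u1, part false u0, part true u1 & u = u0 + u1]].

Definition simple_lie_superalgebra :=
  (exists u v : L, bracket u v <> 0) /\
  forall I : set L, graded_ideal I -> I = [set 0] \/ I = setT.

End Simple.

(* The free Lie superalgebra on even generators x_0, x_1, ... and odd
   generators y_0, y_1, ..., as the algebra of terms modulo the least
   congruence that contains the axioms of Lie superalgebras. *)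
Inductive lterm (F : Type) : Type :=
| Tx of nat
| Ty of nat
| Tzero
| Tadd of lterm F & lterm F
| Tscale of F & lterm F
| Tbr of lterm F & lterm F.
Arguments Tx {F}.
Arguments Ty {F}.
Arguments Tzero {F}.

Inductive thom (F : Type) : bool -> lterm F -> Prop :=
| thom_x i : thom false (Tx i)
| thom_y i : thom true (Ty i)
| thom_zero p : thom p Tzero
| thom_add p s t : thom p s -> thom p t -> thom p (Tadd s t)
| thom_scale p c t : thom p t -> thom p (Tscale c t)
| thom_br p q s t : thom p s -> thom q t -> thom (p (+) q) (Tbr s t).

Inductive lcong (F : fieldType) : lterm F -> lterm F -> Prop :=
| lcong_refl t : lcong t t
| lcong_sym s t : lcong s t -> lcong t s
| lcong_trans s t r : lcong s t -> lcong t r -> lcong s r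
| lcong_add s s' t t' :
    lcong s s' -> lcong t t' -> lcong (Tadd s t) (Tadd s' t')
| lcong_scale c t t' : lcong t t' -> lcong (Tscale c t) (Tscale c t')
| lcong_br s s' t t' :
    lcong s s' -> lcong t t' -> lcong (Tbr s t) (Tbr s' t')
| lcong_addA s t r : lcong (Tadd s (Tadd t r)) (Tadd (Tadd s t) r)
| lcong_addC s t : lcong (Tadd s t) (Tadd t s)
| lcong_add0 t : lcong (Tadd Tzero t) t
| lcong_addN t : lcong (Tadd (Tscale (-1) t) t) Tzero
| lcong_scaleA a b t : lcong (Tscale a (Tscale b t)) (Tscale (a * b) t)
| lcong_scale1 t : lcong (Tscale 1 t) t
| lcong_scaleDr a s t :
    lcong (Tscale a (Tadd s t)) (Tadd (Tscale a s) (Tscale a t))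
| lcong_scaleDl a b t :
    lcong (Tscale (a + b) t) (Tadd (Tscale a t) (Tscale b t))
| lcong_brl a s t r :
    lcong (Tbr (Tadd (Tscale a s) t) r) (Tadd (Tscale a (Tbr s r)) (Tbr t r))
| lcong_brr a s t r :
    lcong (Tbr r (Tadd (Tscale a s) t)) (Tadd (Tscale a (Tbr r s)) (Tbr r t))
| lcong_skew p q s t : thom p s -> thom q t ->
    lcong (Tbr s t) (Tscale (-1) (Tscale ((-1) ^+ (p && q)) (Tbr t s)))
| lcong_jacobi p q s t r : thom p s -> thom q t ->
    lcong (Tbr s (Tbr t r))
          (Tadd (Tbr (Tbr s t) r) (Tscale ((-1) ^+ (p && q)) (Tbr t (Tbr s r)))).

HB.instance Definition _ (F : fieldType) := gen_eqMixin (lterm F).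
HB.instance Definition _ (F : fieldType) := gen_choiceMixin (lterm F).

Section FreeLie.
Variable F : fieldType.

Definition lcongb : rel (lterm F) := fun s t => `[< lcong s t >].

Lemma lcongb_refl : reflexive lcongb.
Proof. by move=> t; apply/asboolP; constructor. Qed.

Lemma lcongb_sym : symmetric lcongb.
Proof. by move=> s t; apply/asboolP/asboolP => ?; apply: lcong_sym. Qed.

Lemma lcongb_trans : transitive lcongb.
Proof.
by move=> t s r /asboolP st /asboolP tr; apply/asboolP; apply: lcong_trans tr.
Qed.

Canonical lcong_equiv := EquivRel lcongb lcongb_refl lcongb_sym lcongb_trans.

Definition freeLie := {eq_quot lcong_equiv}.
HB.instance Definition _ := Choice.on freeLie.
HB.instance Definition _ := EqQuotient.on freeLie.

Definition lcls (t : lterm F) : freeLie := \pi_freeLie t.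

Lemma lclsP s t : lcls s = lcls t <-> lcong s t.
Proof.
rewrite /lcls; split.
  by move=> /eqP; rewrite eqmodE => /asboolP.
by move=> st; apply/eqP; rewrite eqmodE; apply/asboolP.
Qed.

Lemma lrepr_cong t : lcong (repr (lcls t)) t.
Proof. by apply/lclsP; rewrite /lcls reprK. Qed.

Lemma lcls_repr (q : freeLie) : lcls (repr q) = q.
Proof. exact: reprK. Qed.

Let fadd (u v : freeLie) := lcls (Tadd (repr u) (repr v)).
Let fopp (u : freeLie) := lcls (Tscale (-1) (repr u)).
Let fscale (a : F) (u : freeLie) := lcls (Tscale a (repr u)).
Definition fbracket (u v : freeLie) := lcls (Tbr (repr u) (repr v)).

Let faddE s t : fadd (lcls s) (lcls t) = lcls (Tadd s t).
Proof. by apply/lclsP; apply: lcong_add; apply: lrepr_cong. Qed.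

Let fscaleE a t : fscale a (lcls t) = lcls (Tscale a t).
Proof. by apply/lclsP; apply: lcong_scale; apply: lrepr_cong. Qed.

Let foppE t : fopp (lcls t) = lcls (Tscale (-1) t).
Proof. exact: fscaleE. Qed.

Lemma lclsbr s t : lcls (Tbr s t) = fbracket (lcls s) (lcls t).
Proof. by apply/esym/lclsP; apply: lcong_br; apply: lrepr_cong. Qed.

Let fquot (P : freeLie -> Prop) : (forall t, P (lcls t)) -> forall q, P q.
Proof. by move=> H q; rewrite -(lcls_repr q). Qed.

Let faddA : associative fadd.
Proof.
by elim/fquot=> s; elim/fquot=> t; elim/fquot=> r; rewrite !faddE; apply/lclsP;
  constructor.
Qed.

Let faddC : commutative fadd.
Proof.
by elim/fquot=> s; elim/fquot=> t; rewrite !faddE; apply/lclsP; constructor.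
Qed.

Let fadd0 : left_id (lcls Tzero) fadd.
Proof. by elim/fquot=> s; rewrite faddE; apply/lclsP; constructor. Qed.

Let faddN : left_inverse (lcls Tzero) fopp fadd.
Proof. by elim/fquot=> s; rewrite foppE faddE; apply/lclsP; constructor. Qed.

HB.instance Definition _ :=
  GRing.isZmodule.Build freeLie faddA faddC fadd0 faddN.

Let fscaleA a b (v : freeLie) : fscale a (fscale b v) = fscale (a * b) v.
Proof.
by elim/fquot: v => s; rewrite !fscaleE; apply/lclsP; constructor.
Qed.

Let fscale1 : left_id 1 fscale.
Proof. by elim/fquot=> s; rewrite fscaleE; apply/lclsP; constructor. Qed.

Let fscaleDr : right_distributive fscale +%R.
Proof.
move=> a; elim/fquot=> s; elim/fquot=> t.
rewrite -[LHS]/(fscale a (fadd _ _)) -[RHS]/(fadd _ _) !(faddE, fscaleE).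
by apply/lclsP; constructor.
Qed.

Let fscaleDl (v : freeLie) : {morph fscale^~ v : a b / a + b}.
Proof.
elim/fquot: v => s a b; rewrite -[RHS]/(fadd _ _) /= !(faddE, fscaleE).
by apply/lclsP; constructor.
Qed.

HB.instance Definition _ := GRing.Zmodule_isLmodule.Build F freeLie
  fscaleA fscale1 fscaleDr fscaleDl.

Lemma lcls0 : lcls Tzero = 0. Proof. by []. Qed.

Lemma lclsD s t : lcls (Tadd s t) = lcls s + lcls t.
Proof. by rewrite -faddE. Qed.

Lemma lclsZ a t : lcls (Tscale a t) = a *: lcls t.
Proof. by rewrite -fscaleE. Qed.

Definition lclsE := (lcls0, lclsD, lclsZ, lclsbr).

Lemma freeLie_ind (P : freeLie -> Prop) :
  (forall t, P (lcls t)) -> forall q, P q.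
Proof. by move=> H q; rewrite -(lcls_repr q). Qed.

Lemma fbracketZDl (a : F) u v w :
  fbracket (a *: u + v) w = a *: fbracket u w + fbracket v w.
Proof.
elim/freeLie_ind: u => s; elim/freeLie_ind: v => t; elim/freeLie_ind: w => r.
by have /lclsP := lcong_brl a s t r; rewrite !lclsE.
Qed.

Lemma fbracketZDr (a : F) u v w :
  fbracket w (a *: u + v) = a *: fbracket w u + fbracket w v.
Proof.
elim/freeLie_ind: u => s; elim/freeLie_ind: v => t; elim/freeLie_ind: w => r.
by have /lclsP := lcong_brr a s t r; rewrite !lclsE.
Qed.

Definition fpart (p : bool) : set freeLie :=
  [set q | exists2 t, thom p t & q = lcls t].

Lemma fpart0 p : fpart p 0.
Proof. by exists Tzero => //; constructor. Qed.

Lemma fpartZD p (a : F) u v : fpart p u -> fpart p v -> fpart p (a *: u + v).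
Proof.
move=> [s hs ->] [t ht ->]; exists (Tadd (Tscale a s) t); last by rewrite !lclsE.
by do 2?constructor.
Qed.

Lemma fbracket_part p q u v :
  fpart p u -> fpart q v -> fpart (p (+) q) (fbracket u v).
Proof.
by move=> [s hs ->] [t ht ->]; exists (Tbr s t); [constructor|rewrite lclsE].
Qed.

Lemma fbracket_skew p q u v : fpart p u -> fpart q v ->
  fbracket u v = - ((-1) ^+ (p && q) *: fbracket v u).
Proof.
move=> [s hs ->] [t ht ->]; rewrite -scaleN1r.
by have /lclsP := lcong_skew hs ht; rewrite !lclsE.
Qed.

Lemma fbracket_jacobi p q u v w : fpart p u -> fpart q v ->
  fbracket u (fbracket v w) =
    fbracket (fbracket u v) w + (-1) ^+ (p && q) *: fbracket v (fbracket u w).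
Proof.
move=> [s hs ->] [t ht ->]; elim/freeLie_ind: w => r.
by have /lclsP := lcong_jacobi r hs ht; rewrite !lclsE.
Qed.

Lemma fbr0l w : fbracket 0 w = 0.
Proof. by have := fbracketZDl (-1) 0 0 w; rewrite !scaleN1r oppr0 addr0 addNr. Qed.
Lemma fbr0r w : fbracket w 0 = 0.
Proof. by have := fbracketZDr (-1) 0 0 w; rewrite !scaleN1r oppr0 addr0 addNr. Qed.
Lemma fbrDl u v w : fbracket (u + v) w = fbracket u w + fbracket v w.
Proof. by have := fbracketZDl 1 u v w; rewrite !scale1r. Qed.
Lemma fbrDr u v w : fbracket w (u + v) = fbracket w u + fbracket w v.
Proof. by have := fbracketZDr 1 u v w; rewrite !scale1r. Qed.
Lemma fbrZl a u w : fbracket (a *: u) w = a *: fbracket u w.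
Proof. by have := fbracketZDl a u 0 w; rewrite fbr0l !addr0. Qed.
Lemma fbrZr a u w : fbracket w (a *: u) = a *: fbracket w u.
Proof. by have := fbracketZDr a u 0 w; rewrite fbr0r !addr0. Qed.

(* The homogeneous component of parity p. *)
Fixpoint tcomp (p : bool) (t : lterm F) : freeLie :=
  match t with
  | Tx i => if p then 0 else lcls (Tx i)
  | Ty i => if p then lcls (Ty i) else 0
  | Tzero => 0
  | Tadd s t => tcomp p s + tcomp p t
  | Tscale a t => a *: tcomp p t
  | Tbr s t => fbracket (tcomp false s) (tcomp p t)
               + fbracket (tcomp true s) (tcomp (~~ p) t)
  end.

Lemma tcomp_part p t : fpart p (tcomp p t).
Proof.
have D q u v : fpart q u -> fpart q v -> fpart q (u + v).
  by move=> hu hv; rewrite -[u]scale1r; apply: fpartZD.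
elim: t p => [i|i||s hs t ht|a t ht|s hs t ht] p /=.
- case: p; first exact: fpart0.
  by exists (Tx i) => //; constructor.
- case: p; last exact: fpart0.
  by exists (Ty i) => //; constructor.
- exact: fpart0.
- exact: D.
- by rewrite -[_ *: _]addr0; apply: fpartZD => //; apply: fpart0.
- apply: D; first exact: (@fbracket_part false p).
  by have := @fbracket_part true (~~ p) _ _ (hs true) (ht (~~ p)); rewrite addTb negbK.
Qed.

Lemma tcomp_sum t : lcls t = tcomp false t + tcomp true t.
Proof.
elim: t => [i|i||s hs t ht|a t ht|s hs t ht] /=.
- by rewrite addr0.
- by rewrite add0r.
- by rewrite lcls0 addr0.
- by rewrite lclsE hs ht addrACA.
- by rewrite lclsE ht scalerDr.
- by rewrite lclsE hs ht !fbrDl !fbrDr [RHS]addrACA; congr (_ + _); rewrite addrC.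
Qed.

Lemma tcomp_hom p t : thom p t -> tcomp p t = lcls t /\ tcomp (~~ p) t = 0.
Proof.
elim=> {p t} [i|i|p|p s t _ [hs hs'] _ [ht ht']|p c t _ [ht ht']
  |p q s t _ [hs hs'] _ [ht ht']] //=.
- by rewrite hs ht hs' ht' lclsE addr0.
- by rewrite ht ht' lclsE scaler0.
- rewrite lclsE; case: p hs hs' => /= hs hs'; rewrite hs hs' !fbr0l ?addr0 ?add0r;
  case: q ht ht' => /= ht ht'; rewrite ?ht ?ht' ?fbr0r ?addr0; split=> //.
Qed.

Lemma tcomp_cong s t : lcong s t -> forall p, tcomp p s = tcomp p t.
Proof.
elim=> {s t} /=.
- by [].
- by move=> s t _ h p; rewrite h.
- by move=> s t r _ h _ h' p; rewrite h.
- by move=> s s' t t' _ h _ h' p; rewrite h h'.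
- by move=> c t t' _ h p; rewrite h.
- by move=> s s' t t' _ h _ h' p; rewrite !h !h'.
- by move=> *; rewrite addrA.
- by move=> *; rewrite addrC.
- by move=> *; rewrite add0r.
- by move=> *; rewrite scaleN1r addNr.
- by move=> *; rewrite scalerA.
- by move=> *; rewrite scale1r.
- by move=> *; rewrite scalerDr.
- by move=> *; rewrite scalerDl.
- by move=> *; rewrite !fbracketZDl scalerDr addrACA.
- by move=> *; rewrite !fbracketZDr scalerDr addrACA.
- move=> p q s t /[dup] ps /tcomp_hom [hs hs'] /[dup] qt /tcomp_hom [ht ht'] r.
  have key : fbracket (lcls s) (lcls t) =
      -1 *: ((-1) ^+ (p && q) *: fbracket (lcls t) (lcls s)).
    by rewrite scaleN1r; apply: fbracket_skew; eexists; eauto.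
  by move: hs hs' ht ht' key; case: p {ps}; case: q {qt}; case: r => /=
    -> -> -> -> key; rewrite ?(fbr0l, fbr0r, add0r, addr0, scaler0).
- move=> p q s t r /[dup] ps /tcomp_hom [hs hs'] /[dup] qt /tcomp_hom [ht ht'] z.
  have key w : fbracket (lcls s) (fbracket (lcls t) w) =
      fbracket (fbracket (lcls s) (lcls t)) w
      + (-1) ^+ (p && q) *: fbracket (lcls t) (fbracket (lcls s) w).
    by apply: fbracket_jacobi; eexists; eauto.
  by move: hs hs' ht ht' key; case: p {ps}; case: q {qt}; case: z => /=
    -> -> -> -> key; rewrite ?(fbr0l, fbr0r, add0r, addr0, scaler0) key.
Qed.

Lemma fpart_direct u : fpart false u -> fpart true u -> u = 0.
Proof.
move=> [s hs ->] [t ht /lclsP st].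
have [<- _] := tcomp_hom hs; rewrite (tcomp_cong st).
by have [_] := tcomp_hom ht.
Qed.

Lemma fpart_decomp u :
  exists u0 u1, [/\ fpart false u0, fpart true u1 & u = u0 + u1].
Proof.
elim/freeLie_ind: u => t; exists (tcomp false t), (tcomp true t).
by split; [exact: tcomp_part|exact: tcomp_part|exact: tcomp_sum].
Qed.

HB.instance Definition _ := isLieSuperalgebra.Build F freeLie
  fpart0 fpartZD fpart_direct fpart_decomp fbracketZDl fbracketZDr
  fbracket_part fbracket_skew fbracket_jacobi.

End FreeLie.

Section Evaluation.
Variables (F : fieldType) (L : lieSuperalgType F).
Implicit Types a b : nat -> L.

Fixpoint teval a b (t : lterm F) : L :=
  match t with
  | Tx i => a i
  | Ty i => b i
  | Tzero => 0
  | Tadd s t => teval a b s + teval a b t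
  | Tscale c t => c *: teval a b t
  | Tbr s t => bracket (teval a b s) (teval a b t)
  end.

(* f(a_0, a_1, ..., b_0, b_1, ...); it does not depend on the representative
   when the a_i are even and the b_i are odd, see leval_cls. *)
Definition leval a b (f : freeLie F) : L := teval a b (repr f).

Definition gradedId : set (freeLie F) :=
  [set f | forall a b : nat -> L,
     (forall i, part false (a i)) -> (forall i, part true (b i)) ->
     leval a b f = 0].

Section EvalTheory.
Variables (a b : nat -> L).
Hypothesis ha : forall i, part false (a i).
Hypothesis hb : forall i, part true (b i).

Lemma teval_part p t : thom p t -> part p (teval a b t).
Proof.
elim=> {p t} //= [p|p s t _ hs _ ht|p c t _ ht|p q s t _ hs _ ht].
- exact: part0.
- by rewrite -[teval a b s]scale1r; apply: partZD.
- by rewrite -[_ *: _]addr0; apply: partZD => //; apply: part0.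
- exact: bracket_part.
Qed.

Lemma teval_cong s t : lcong s t -> teval a b s = teval a b t.
Proof.
elim=> {s t} /=.
- by [].
- by move=> s t _ ->.
- by move=> s t r _ -> _ ->.
- by move=> s s' t t' _ -> _ ->.
- by move=> c t t' _ ->.
- by move=> s s' t t' _ -> _ ->.
- by move=> *; rewrite addrA.
- by move=> *; rewrite addrC.
- by move=> *; rewrite add0r.
- by move=> *; rewrite scaleN1r addNr.
- by move=> *; rewrite scalerA.
- by move=> *; rewrite scale1r.
- by move=> *; rewrite scalerDr.
- by move=> *; rewrite scalerDl.
- by move=> *; rewrite bracketZDl.
- by move=> *; rewrite bracketZDr.
- move=> p q s t /teval_part hs /teval_part ht.
  by rewrite scaleN1r; apply: bracket_skew.
- by move=> p q s t r /teval_part hs /teval_part ht; apply: bracket_jacobi.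
Qed.

Lemma leval_cls t : leval a b (lcls t) = teval a b t.
Proof. exact/teval_cong/lrepr_cong. Qed.

Lemma levalZD c f g : leval a b (c *: f + g) = c *: leval a b f + leval a b g.
Proof.
elim/freeLie_ind: f => s; elim/freeLie_ind: g => t.
by rewrite -lclsZ -lclsD !leval_cls.
Qed.

Lemma leval_bracket f g :
  leval a b (bracket f g) = bracket (leval a b f) (leval a b g).
Proof.
elim/freeLie_ind: f => s; elim/freeLie_ind: g => t.
by rewrite /bracket /= -lclsbr !leval_cls.
Qed.

Lemma leval_part p f : part p f -> part p (leval a b f).
Proof. by move=> [t ht ->]; rewrite leval_cls; apply: teval_part. Qed.

Lemma leval_unique (h : freeLie F -> L) :
  (forall c f g, h (c *: f + g) = c *: h f + h g) ->
  (forall f g, h (bracket f g) = bracket (h f) (h g)) ->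
  (forall i, h (lcls (Tx i)) = a i) -> (forall i, h (lcls (Ty i)) = b i) ->
  h = leval a b.
Proof.
move=> hlin hbr hx hy; apply/funext; elim/freeLie_ind => t.
have h0 : h 0 = 0.
  by have := hlin (-1) 0 0; rewrite !scaleN1r oppr0 addr0 addNr.
rewrite leval_cls; elim: t => [i|i||s hs t ht|c t ht|s hs t ht] //=.
- by have := hlin 1 (lcls s) (lcls t); rewrite !scale1r lclsE hs ht.
- by rewrite lclsE -[_ *: _]addr0 hlin h0 addr0 ht.
- by rewrite lclsE -hs -ht -hbr.
Qed.

End EvalTheory.
End Evaluation.

Inductive mono : Type :=
| Mx of nat
| My of nat
| Mbr of mono & mono.

Fixpoint leaves (m : mono) : seq (nat + nat) :=
  match m with
  | Mx i => [:: inl i]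
  | My j => [:: inr j]
  | Mbr u v => leaves u ++ leaves v
  end.

Fixpoint mono_val (F : fieldType) (m : mono) : freeLie F :=
  match m with
  | Mx i => lcls (Tx i)
  | My j => lcls (Ty j)
  | Mbr u v => bracket (mono_val F u) (mono_val F v)
  end.

(* Indices start at 0: the variables are x_0, ..., x_(k-1), y_0, ..., y_(l-1). *)
Definition mvars (k l : nat) : seq (nat + nat) :=
  [seq inl i | i <- iota 0 k] ++ [seq inr j | j <- iota 0 l].

Definition multilinear (k l : nat) (m : mono) : bool :=
  perm_eq (leaves m) (mvars k l).

Section Codimensions.
Variable F : fieldType.

(* P_{k,l} *)
Definition mpart (k l : nat) : set (freeLie F) :=
  lspan [set mono_val F m | m in [set m | multilinear k l m]].

Variable L : lieSuperalgType F.

(* c_{k,l}(L) *)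
Definition codim (k l : nat) : nat :=
  quot_dim (mpart k l) (mpart k l `&` gradedId L).

(* c_n^gr(L) *)
Definition gr_codim (n : nat) : nat :=
  (\sum_(k < n.+1) 'C(n, k) * codim k (n - k))%N.

End Codimensions.

Section Finiteness.
Variables (F : fieldType) (M : lmodType F).
Implicit Types (V W : set M).

Lemma quot_dim_exists V W N (e : 'I_N -> M) : is_submodule W ->
  (forall i, V (e i)) ->
  (forall v, V v -> exists c : 'rV[F]_N, W (v - \sum_i c 0 i *: e i)) ->
  exists n, has_quot_dim V W n.
Proof.
move=> [W0 WZD]; elim: N e => [|N IH] e hV hgen.
  exists 0%N, e; split=> // v /hgen [c hc]; exists c; split=> // c' _.
  by apply/rowP; case.
have [hu|] := pselect (forall v, V v ->
    exists! c : 'rV[F]_N.+1, W (v - \sum_i c 0 i *: e i)).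
  by exists N.+1, e.
move=> /existsNP [v /not_implyP [Vv nu]]; have [c hc] := hgen v Vv.
have [c' [hc' /eqP cc']] : exists c' : 'rV[F]_N.+1,
    W (v - \sum_i c' 0 i *: e i) /\ c <> c'.
  apply: contrapT => H; apply: nu; exists c; split=> // c' hc'.
  by apply: contrapT => ?; apply: H; exists c'.
have {hc hc'} [d [d0 hd]] : exists d : 'rV[F]_N.+1,
    d != 0 /\ W (\sum_i d 0 i *: e i).
  exists (c - c'); split; first by rewrite subr_eq0.
  have := WZD (-1) _ _ hc hc'; rewrite scaleN1r opprB.
  rewrite addrA subrK -sumrB => h; under eq_bigr do rewrite !mxE scalerBl.
  exact: h.
have [j dj] : exists j, d 0 j != 0.
  apply: contrapT => H; move/eqP: d0; apply; apply/rowP => j; rewrite mxE.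
  by apply/eqP; apply: contrapT => /negP ?; apply: H; exists j.
apply: (IH (fun i => e (lift j i))) => [i|w Vw]; first exact: hV.
have [b hb] := hgen w Vw.
exists (\row_i (b 0 (lift j i) - b 0 j / d 0 j * d 0 (lift j i))).
have := WZD (b 0 j / d 0 j) _ _ hd hb; congr W.
under [in RHS]eq_bigr do rewrite mxE scalerBl -scalerA.
rewrite sumrB -scaler_sumr !(bigD1_ord j (P := xpredT)) //=.
rewrite scalerDr scalerA divfK // opprD opprB [X in _ + X]addrCA addrACA subrr.
by rewrite add0r addrCA.
Qed.

Lemma quot_dim_unique V W n m : is_submodule W ->
  has_quot_dim V W n -> has_quot_dim V W m -> n = m.
Proof.
move=> [W0 WZD].
have WD u v : W u -> W v -> W (u + v).
  by move=> hu hv; rewrite -[u]scale1r; apply: WZD.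
have WZ c u : W u -> W (c *: u) by move=> hu; rewrite -[_ *: _]addr0; apply: WZD.
have Wsum (I : finType) (f : I -> M) : (forall i, W (f i)) -> W (\sum_i f i).
  by move=> hf; elim/big_ind: _ => //; apply: WD.
suff le p q : has_quot_dim V W p -> has_quot_dim V W q -> (p <= q)%N.
  by move=> hn hm; apply/eqP; rewrite eqn_leq !le.
move=> [e [Ve he]] [f [Vf hf]].
have /choice [A hA] : forall i, exists c : 'rV[F]_q, W (e i - \sum_j c 0 j *: f j).
  by move=> i; have [c [hc _]] := hf _ (Ve i); exists c.
have /choice [B hB] : forall j, exists c : 'rV[F]_p, W (f j - \sum_i c 0 i *: e i).
  by move=> j; have [c [hc _]] := he _ (Vf j); exists c.
pose MA := \matrix_(i, j) A i 0 j; pose MB := \matrix_(j, i) B j 0 i.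
suff AB : MA *m MB = 1%:M by exact: mulmx1_min AB.
apply/row_matrixP => i; have [c [_ uc]] := he _ (Ve i).
transitivity c; last apply/uc; first apply/esym/uc.
- have := WD _ _ (hA i) (Wsum _ _ (fun j => WZ (A i 0 j) _ (hB j))).
  congr W; rewrite -addrA; congr (_ + _).
  under [X in _ + X = _]eq_bigr do rewrite scalerBr.
  rewrite sumrB addrA addNr add0r; congr (- _).
  under eq_bigr do rewrite scaler_sumr.
  rewrite exchange_big /=; apply: eq_bigr => k _; rewrite !mxE scaler_suml.
  by apply: eq_bigr => j _; rewrite !mxE scalerA.
- rewrite (bigD1 i) //= big1 => [|k ki]; rewrite !mxE ?eqxx.
    by rewrite scale1r addr0 subrr.
  by rewrite eq_sym (negPf ki) scale0r.
Qed.

Lemma quot_dimP V W N (e : 'I_N -> M) : is_submodule W ->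
  (forall i, V (e i)) ->
  (forall v, V v -> exists c : 'rV[F]_N, W (v - \sum_i c 0 i *: e i)) ->
  has_quot_dim V W (quot_dim V W).
Proof. by move=> hW hV hgen; apply: xgetPex; apply: quot_dim_exists hgen. Qed.

Lemma lspan_submodule (A : set M) : is_submodule (lspan A).
Proof.
split; first by exists 0%N, (fun=> 0), (fun=> 0); split=> [[]|] //; rewrite big_ord0.
move=> a u v [n [c [e [he ->]]]] [n' [c' [e' [he' ->]]]]; exists (n + n')%N.
exists (fun i => match split i with inl j => a * c j | inr j => c' j end).
exists (fun i => match split i with inl j => e j | inr j => e' j end).
split; first by move=> i; case: (split i).
rewrite big_split_ord /= scaler_sumr; congr (_ + _); apply: eq_bigr => i _.
  by have := unsplitK (inl i : 'I_n + 'I_n') => /= ->; rewrite scalerA.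
by have := unsplitK (inr i : 'I_n + 'I_n') => /= ->.
Qed.

End Finiteness.

Section CodimensionsFinite.
Variables (F : fieldType) (L : lieSuperalgType F) (k l : nat).

HB.instance Definition _ := gen_eqMixin mono.

Let gen (z : nat + nat) : mono :=
  match z with inl i => Mx i | inr j => My j end.

Let gens := [seq gen z | z <- mvars k l].

Fixpoint monos (d : nat) : seq mono :=
  if d is d'.+1 then gens ++ [seq Mbr u v | u <- monos d', v <- monos d']
  else gens.

Let gens_monos d z : z \in mvars k l -> gen z \in monos d.
Proof. by move=> hz; case: d => [|d]; rewrite /= ?mem_cat map_f. Qed.

Let leaves_gt0 m : (0 < size (leaves m))%N.
Proof. by elim: m => //= u hu v hv; rewrite size_cat addn_gt0 hu. Qed.

Lemma mem_monos m d : {subset leaves m <= mvars k l} ->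
  (size (leaves m) <= d.+1)%N -> m \in monos d.
Proof.
elim: m d => [i|j|u hu v hv] d hm.
- by move=> _; apply: (gens_monos d (z := inl i)); apply: hm; rewrite /= inE.
- by move=> _; apply: (gens_monos d (z := inr j)); apply: hm; rewrite /= inE.
rewrite /= size_cat; case: d => [|d] hd.
  have := leq_add (leaves_gt0 u) (leaves_gt0 v).
  by move=> /leq_trans /(_ hd).
rewrite mem_cat; apply/orP; right; apply: allpairs_f.
- apply: hu => [z zu|]; first by apply: hm; rewrite /= mem_cat zu.
  rewrite -ltnS; apply: leq_trans hd.
  by rewrite -[ltnLHS]addn0 ltn_add2l.
- apply: hv => [z zv|]; first by apply: hm; rewrite /= mem_cat zv orbT.
  rewrite -ltnS; apply: leq_trans hd.
  by rewrite -[ltnLHS]add0n ltn_add2r.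
Qed.

Let ms := [seq m <- monos (k + l) | multilinear k l m].

Let mem_ms m : multilinear k l m -> m \in ms.
Proof.
move=> hm; rewrite mem_filter hm; apply: mem_monos => [z|].
  by rewrite (perm_mem hm).
by rewrite (perm_size hm) size_cat !size_map !size_iota.
Qed.

Lemma gradedId_submodule : is_submodule (gradedId L).
Proof.
split=> [a b ha hb|c f g hf hg a b ha hb].
  have := levalZD ha hb (-1) 0 0.
  by rewrite !scaleN1r oppr0 addr0 addNr.
by rewrite levalZD // hf // hg // scaler0 addr0.
Qed.

Lemma codimP :
  has_quot_dim (@mpart F k l) (@mpart F k l `&` gradedId L) (codim L k l).
Proof.
have [P0 PZD] := lspan_submodule [set mono_val F m | m in [set m | multilinear k l m]].
have [I0 IZD] := gradedId_submodule.
pose e (i : 'I_(size ms)) := mono_val F (nth (Mx 0) ms i).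
apply: (quot_dimP (e := e)).
- split=> [|a u v [? ?] [? ?]]; first by split.
  by split; [apply: PZD|apply: IZD].
- move=> i; exists 1%N, (fun=> 1), (fun=> e i); split; last first.
    by rewrite big_ord1 scale1r.
  move=> _; exists (nth (Mx 0) ms i) => //=.
  by have := mem_nth (Mx 0) (ltn_ord i); rewrite mem_filter => /andP[].
move=> v [n [c [f [hf vE]]]].
suff [d ->] : exists d : 'rV[F]_(size ms), v = \sum_i d 0 i *: e i.
  by exists d; rewrite subrr; split.
rewrite {}vE; elim/big_ind: _ => [|_ _ [d ->] [d' ->]|i _].
- by exists 0; rewrite big1 // => i _; rewrite mxE scale0r.
- exists (d + d'); rewrite -big_split; apply: eq_bigr => i _.
  by rewrite mxE scalerDl.
have [m /mem_ms hm <-] := hf i.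
have hi : (index m ms < size ms)%N by rewrite index_mem.
exists (c i *: delta_mx 0 (Ordinal hi)).
rewrite (bigD1 (Ordinal hi)) //= big1 => [|j ji].
  by rewrite addr0 !mxE !eqxx mulr1 /e /= nth_index.
by rewrite !mxE (negPf ji) andbF mulr0 scale0r.
Qed.

End CodimensionsFinite.

Section Exponent.
Variables (R : realType) (F : fieldType) (L : lieSuperalgType F).

Definition root_codim (n : nat) : R := ((gr_codim L n)%:R : R) `^ (n%:R^-1).

(* Meaningful when root_codim converges. *)
Definition exp_gr : R := limn root_codim.

End Exponent.

(* Main.v *)
(* Codimensions are supermultiplicative up to a constant:
   c_n c_m <= d^2 c_{n+m+C} for some fixed C. Since L = [L, L], the operators
   ad z_1 ... ad z_C of one fixed length C span a space stable under left
   multiplication by ad L. Given a basis f_1, ..., f_N of P_{k,l}(L), choose a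
   largest subfamily, say f_1, ..., f_r, for which the vectors
   (z(f_1), ..., z(f_r)), with z a word of length C, span L^r. By simplicity
   every f_i is a sum over j <= r of theta_ij(f_j) with theta_ij in End(L), so
   that N <= r d^2. For a basis (g_j) of P_{k',l'}(L), the polynomials
   [z(f_i), g_j] with i <= r are then jointly independent modulo the identities,
   because L has no center. Summing over k, k' and the parities of the letters
   of z gives the inequality, and Fekete's lemma gives the limit. The bound
   c_n <= d^(n+1) holds since a multilinear map is determined by its values on
   homogeneous bases. *)
Require Import Defs.
From HB Require Import structures.
From mathcomp Require Import all_boot all_order all_algebra.
From mathcomp Require Import boolp classical_sets reals topology normedtype.
From mathcomp Require Import sequences exp.
From mathcomp Require Import ring lra.

Set Implicit Arguments.
Unset Strict Implicit.
Unset Printing Implicit Defensive.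
Import Order.TTheory GRing.Theory Num.Theory.
Import numFieldNormedType.Exports.

Local Open Scope classical_set_scope.
Local Open Scope ring_scope.

(** * Submodules and linear spans *)

Section SubmoduleTheory.
Variables (F : fieldType) (M : lmodType F).
Implicit Types (A V W : set M).

Lemma submodD V u v : is_submodule V -> V u -> V v -> V (u + v).
Proof. by move=> [_ VZD] Vu Vv; rewrite -[u]scale1r; apply: VZD. Qed.

Lemma submodZ V c u : is_submodule V -> V u -> V (c *: u).
Proof. by move=> [V0 VZD] Vu; rewrite -[_ *: _]addr0; apply: VZD. Qed.

Lemma submodB V u v : is_submodule V -> V u -> V v -> V (u - v).
Proof. by move=> [_ VZD] Vu Vv; rewrite addrC -scaleN1r; apply: VZD. Qed.

Lemma submod_sum V (I : Type) (r : seq I) (P : pred I) (f : I -> M) :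
  is_submodule V -> (forall i, P i -> V (f i)) -> V (\sum_(i <- r | P i) f i).
Proof.
by move=> hV hf; elim/big_ind: _ => // [|u v]; [case: hV|apply: submodD].
Qed.

Lemma lspan_sub A V : is_submodule V -> A `<=` V -> lspan A `<=` V.
Proof.
move=> hV AV _ [n [c [e [Ae ->]]]].
by apply: submod_sum => // i _; apply: submodZ => //; apply: AV.
Qed.

Lemma mem_lspan A u : A u -> lspan A u.
Proof.
by exists 1%N, (fun=> 1), (fun=> u); split=> //; rewrite big_ord1 scale1r.
Qed.

(** The vectors with both homogeneous components in the span form a submodule containing [A]. Parity
    is an abstract [P], so that this serves both in L and in L^N. *)
Lemma lspan_homogeneous (P : bool -> set M) A :
  (forall p, is_submodule (P p)) -> (forall u, A u -> exists p, P p u) ->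
  forall u, lspan A u -> exists u0 u1,
    [/\ lspan A u0, lspan A u1, P false u0, P true u1 & u = u0 + u1].
Proof.
move=> hP hA; pose V := [set u | exists u0 u1,
    [/\ lspan A u0, lspan A u1, P false u0, P true u1 & u = u0 + u1]].
have sA := lspan_submodule A; have [A0 AZD] := sA.
have [P00 P0ZD] := hP false; have [P10 P1ZD] := hP true.
suff : lspan A `<=` V by [].
apply: lspan_sub; first split.
- by exists 0, 0; rewrite addr0.
- move=> a _ _ [u0 [u1 [? ? ? ? ->]]] [v0 [v1 [? ? ? ? ->]]].
  exists (a *: u0 + v0), (a *: u1 + v1).
  split; [exact: AZD|exact: AZD|exact: P0ZD|exact: P1ZD|].
  by rewrite scalerDr addrACA.
- move=> u /[dup] Au /hA [[] Pu].
    by exists 0, u; split=> //; [exact: mem_lspan|rewrite add0r].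
  by exists u, 0; split=> //; [exact: mem_lspan|rewrite addr0].
Qed.

End SubmoduleTheory.

(** * Dimension estimates through linear maps and quotients *)

Section Dimensions.
Variable F : fieldType.

Lemma linear_lfun (U V : vectType F) (g : U -> V) :
  linear g -> exists f : 'Hom(U, V), f =1 g.
Proof.
move=> glin; pose gl : {linear U -> V} :=
  HB.pack g (GRing.isLinear.Build F U V *:%R g glin).
by exists (linfun gl) => u; rewrite lfunE.
Qed.

Lemma dim_le_injective (U V : vectType F) (g : U -> V) :
  linear g -> (forall u, g u = 0 -> u = 0) -> (\dim {:U} <= \dim {:V})%N.
Proof.
move=> /linear_lfun[f fg] ginj; rewrite -(limg_ker_dim f) capfv.
suff /eqP -> : lker f == 0%VS by rewrite dimv0 dimvS ?subvf.
rewrite -subv0; apply/subvP => u; rewrite memv_ker fg memv0 => /eqP /ginj ->.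
by [].
Qed.

(** A subspace of maximal dimension inside [V] absorbs each vector of [V], since adjoining that
    vector cannot raise the dimension. *)
Lemma submodule_vspace (U : vectType F) (V : set U) :
  is_submodule V -> exists K : {vspace U}, forall u, V u <-> u \in K.
Proof.
move=> hV.
pose P n := `[< exists2 K : {vspace U}, {in K, forall u, V u} & \dim K = n >].
have P0 : exists n, P n.
  exists 0%N; apply/asboolP; exists 0%VS; last exact: dimv0.
  by move=> u; rewrite memv0 => /eqP ->; case: hV.
have Ple n : P n -> (n <= \dim {:U})%N.
  by move=> /asboolP[K _ <-]; rewrite dimvS ?subvf.
have [n /asboolP[K KV <-] Kmax] := ex_maxnP P0 Ple.
exists K => u; split=> [Vu|/KV //].
suff /eqP -> : K == (K + <[u]>)%VS by rewrite memvE addvSr.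
rewrite -(dimv_leqif_eq (addvSl K <[u]>)) eqn_leq dimvS ?addvSl //=.
apply/Kmax/asboolP; exists (K + <[u]>)%VS => // w /memv_addP[x /KV Vx].
by move=> [_ /vlineP[c ->] ->]; apply: submodD => //; apply: submodZ.
Qed.

(* Each quotient V / W of dimension n costs at most n dimensions of the
   subspace mapped into W. *)
Lemma quot_dim_kernel (M : lmodType F) (V W : set M) n (U : vectType F)
    (g : U -> M) (K : {vspace U}) :
  is_submodule W -> has_quot_dim V W n -> linear g -> (forall u, V (g u)) ->
  exists K' : {vspace U}, [/\ (K' <= K)%VS, (\dim K <= \dim K' + n)%N &
    {in K', forall u, W (g u)}].
Proof.
move=> hW [e [_ he]] glin gV.
have /choice [c hc] : forall u, exists c : 'rV[F]_n,
    W (g u - \sum_i c 0 i *: e i).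
  by move=> u; have [c []] := he _ (gV u); exists c.
have uc u (x : 'rV[F]_n) : W (g u - \sum_i x 0 i *: e i) -> c u = x.
  by have [y [_ uy]] := he _ (gV u) => hx; rewrite -(uy _ hx) (uy _ (hc u)).
(* Uniqueness of coordinates modulo [W] makes the coordinate map linear; [K'] is its kernel within
   [K]. *)
have clin : linear c.
  move=> a u v; apply: uc; rewrite glin.
  have := hW.2 a _ _ (hc u) (hc v); congr (W _).
  under [in RHS]eq_bigr do rewrite !mxE scalerDl -scalerA.
  by rewrite big_split -scaler_sumr /= scalerBr opprD addrACA.
have [f fc] := linear_lfun clin.
exists (K :&: lker f)%VS; split; first exact: capvSl.
  rewrite -(limg_ker_dim f K) leq_add2l (leq_trans (dimvS (subvf _))) //.
  by rewrite dimvf dim_matrix mul1r.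
move=> u; rewrite memv_cap memv_ker fc => /andP[_ /eqP cu].
have := hc u; rewrite cu big1 ?subr0 // => i _.
by rewrite mxE scale0r.
Qed.

(** The subspaces of [quot_dim_kernel] shrink along [s], each time by at most [n i] dimensions;
    joint injectivity makes the last one zero. *)
Lemma dim_le_sum_quot_dim (M : lmodType F) (I : eqType) (s : seq I)
    (V W : I -> set M) (n : I -> nat) (U : vectType F) (g : I -> U -> M) :
  (forall i, is_submodule (W i)) ->
  (forall i, has_quot_dim (V i) (W i) (n i)) ->
  (forall i, linear (g i)) -> (forall i, i \in s -> forall u, V i (g i u)) ->
  (forall u, (forall i, i \in s -> W i (g i u)) -> u = 0) ->
  (\dim {:U} <= \sum_(i <- s) n i)%N.
Proof.
move=> hW hn glin gV ginj.
suff [K [dK hK]] : exists K : {vspace U},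
    (\dim {:U} <= \dim K + \sum_(i <- s) n i)%N /\
    {in K, forall u, forall i, i \in s -> W i (g i u)}.
  suff K0 : K = 0%VS by move: dK; rewrite K0 dimv0.
  by apply/eqP; rewrite -subv0; apply/subvP => u /hK /ginj ->; rewrite mem0v.
elim: s gV {ginj} => [|i s IH] gV.
  by exists fullv; rewrite big_nil addn0.
have [j js|K [dK hK]] := IH; first by apply: gV; rewrite inE js orbT.
have [K' [K'K dK' hK']] := quot_dim_kernel K (hW i) (hn i) (glin i)
  (gV i (mem_head i s)).
exists K'; split=> [|u uK' j].
  by rewrite big_cons addnA (leq_trans dK) // leq_add2r.
rewrite inE => /predU1P[->|]; first exact: hK'.
by apply: hK; apply: subvP uK'.
Qed.

End Dimensions.

(** * Trivial center and perfectness of a simple Lie superalgebra *)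

Section LieTheory.
Variables (F : fieldType) (L : lieSuperalgType F).
Implicit Types (u v w z : L) (p q : bool).

Lemma br0l w : bracket 0 w = 0.
Proof. by have := bracketZDl (-1) 0 0 w; rewrite !scaleN1r oppr0 addr0 addNr. Qed.

Lemma br0r w : bracket w 0 = 0.
Proof. by have := bracketZDr (-1) 0 0 w; rewrite !scaleN1r oppr0 addr0 addNr. Qed.

Lemma brDl u v w : bracket (u + v) w = bracket u w + bracket v w.
Proof. by have := bracketZDl 1 u v w; rewrite !scale1r. Qed.

Lemma brDr u v w : bracket w (u + v) = bracket w u + bracket w v.
Proof. by have := bracketZDr 1 u v w; rewrite !scale1r. Qed.

Lemma brZr c u w : bracket w (c *: u) = c *: bracket w u.
Proof. by have := bracketZDr c u 0 w; rewrite br0r !addr0. Qed.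

Lemma brBr u v w : bracket w (u - v) = bracket w u - bracket w v.
Proof. by rewrite -scaleN1r brDr brZr scaleN1r. Qed.

Lemma br_sumr (I : Type) (r : seq I) (P : pred I) (f : I -> L) w :
  bracket w (\sum_(i <- r | P i) f i) = \sum_(i <- r | P i) bracket w (f i).
Proof. by apply: (big_morph (bracket w)) => [u v|]; rewrite ?brDr ?br0r. Qed.

Lemma part_submodule p : is_submodule (@part F L p).
Proof. by split; [exact: part0|exact: partZD]. Qed.

Lemma part_add0 u v p :
  part p u -> part (~~ p) v -> u + v = 0 -> u = 0 /\ v = 0.
Proof.
move=> pu pv /eqP; rewrite addr_eq0 => /eqP uv.
suff u0 : u = 0 by split=> //; apply/eqP; rewrite -oppr_eq0 -uv u0.
have pu' : part (~~ p) u.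
  by rewrite uv -scaleN1r; apply: submodZ => //; apply: part_submodule.
by case: p pu {pv} pu' => pu pu'; apply: part_direct.
Qed.

(** Skew symmetry holds between homogeneous elements, so closure on the right follows from closure
    on the left after splitting both arguments; for the one in [I] this uses the grading of [I]. *)
Lemma graded_ideal_left (I : set L) : is_submodule I ->
  (forall p z u, part p z -> I u -> I (bracket z u)) ->
  (forall u, I u -> exists u0 u1,
     [/\ I u0, I u1, part false u0, part true u1 & u = u0 + u1]) ->
  graded_ideal I.
Proof.
move=> hI Il Ig; split=> // u v Iu; have [v0 [v1 [pv0 pv1 ->]]] := part_decomp v.
have brI p q x y : I x -> part p x -> part q y -> I (bracket x y).
  move=> Ix px qy; rewrite (bracket_skew _ _ _ _ px qy) -scaleN1r.
  by do 2 apply: submodZ => //; apply: Il qy Ix.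
split; last by rewrite brDl; apply: submodD => //; apply: Il; eauto.
have [u0 [u1 [Iu0 Iu1 pu0 pu1 ->]]] := Ig _ Iu.
by rewrite brDr !brDl; do !apply: submodD => //; apply: brI; eauto.
Qed.

Hypothesis L_simple : simple_lie_superalgebra L.

(** The elements annihilated by L form a graded ideal, which is not all of L because some bracket is
    nonzero. *)
Lemma center_trivial u : (forall p z, part p z -> bracket z u = 0) -> u = 0.
Proof.
move=> hu; pose Z := [set u | forall p z, part p z -> bracket z u = 0].
have : graded_ideal Z.
  apply: graded_ideal_left.
  - split=> [p z _|a v w Zv Zw p z pz]; first exact: br0r.
    by rewrite bracketZDr (Zv p) // (Zw p) // scaler0 addr0.
  - by move=> p z v pz Zv q y qy; rewrite (Zv p z pz) br0r.
  - move=> v Zv; have [v0 [v1 [pv0 pv1 vE]]] := part_decomp v.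
    (* The two brackets have opposite parities and sum to zero, so each vanishes. *)
    have key p z : part p z -> bracket z v0 = 0 /\ bracket z v1 = 0.
      move=> pz; apply: (@part_add0 _ _ p).
      - by have := bracket_part _ _ _ _ pz pv0; rewrite addbF.
      - by have := bracket_part _ _ _ _ pz pv1; rewrite addbT.
      - by rewrite -brDr -vE (Zv p).
    exists v0, v1; split=> //; move=> p z pz; by have [] := key p z pz.
move=> /(L_simple.2) [ZE|ZE].
  by have : Z u by []; rewrite ZE.
have [x [y []]] := L_simple.1.
have Zy : Z y by rewrite ZE.
have [x0 [x1 [px0 px1 ->]]] := part_decomp x.
by rewrite brDl (Zy _ _ px0) (Zy _ _ px1) addr0.
Qed.

Definition homogeneous_brackets : set L :=
  [set w | exists p q u v, [/\ part p u, part q v & w = bracket u v]].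

(** The brackets span a nonzero graded ideal. Taking homogeneous factors makes the span graded and
    the Jacobi identity applicable in [words1]. *)
Lemma simple_perfect w : lspan homogeneous_brackets w.
Proof.
have hJ := lspan_submodule homogeneous_brackets.
have brJ u v : lspan homogeneous_brackets (bracket u v).
  have [u0 [u1 [pu0 pu1 ->]]] := part_decomp u.
  have [v0 [v1 [pv0 pv1 ->]]] := part_decomp v.
  rewrite !brDl !brDr; do !apply: submodD => //; apply: mem_lspan.
  - by exists false, false, u0, v0.
  - by exists false, true, u0, v1.
  - by exists true, false, u1, v0.
  - by exists true, true, u1, v1.
have : graded_ideal (lspan homogeneous_brackets).
  apply: graded_ideal_left => //.
  apply: lspan_homogeneous; first exact: part_submodule.
  move=> _ [p [q [u [v [pu qv ->]]]]]; exists (p (+) q); exact: bracket_part.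
move=> /(L_simple.2) [JE|->] //.
by have [x [y []]] := L_simple.1; have := brJ x y; rewrite JE.
Qed.

End LieTheory.

(** * Iterated adjoint operators with homogeneous letters *)

Section Words.
Variables (F : fieldType) (L : lieSuperalgType F).
Implicit Types (p : seq bool) (z : seq L) (u v : L).

Fixpoint homogeneous p z : Prop :=
  match p, z with
  | [::], [::] => True
  | i :: p', u :: z' => part i u /\ homogeneous p' z'
  | _, _ => False
  end.

(* The head of z acts first: word [:: z1; z2] u = [z2, [z1, u]]. *)
Definition word z u := foldl (fun v x => bracket x v) u z.

Lemma word_linear z : linear (word z).
Proof.
elim: z => //= x z IH a u v.
by rewrite -[LHS]/(word z (bracket x (a *: u + v))) bracketZDr IH.
Qed.

Lemma word_cat z z' u : word (z ++ z') u = word z' (word z u).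
Proof. exact: foldl_cat. Qed.

Lemma word_rcons z x u : word (rcons z x) u = bracket x (word z u).
Proof. by rewrite -cats1 word_cat. Qed.

Lemma word_part p z i u :
  homogeneous p z -> part i u -> part (foldl addb i p) (word z u).
Proof.
elim: p z i u => [|j p IH] [|x z] i u //= [px hz] pu; apply: IH => //.
by rewrite addbC; apply: bracket_part.
Qed.

Lemma homogeneous_rcons p z i x :
  homogeneous p z -> part i x -> homogeneous (rcons p i) (rcons z x).
Proof. by elim: p z => [|j p IH] [|y z] //= [py hz] px; split; auto. Qed.

Lemma homogeneous_rconsE p z : homogeneous p z -> (0 < size p)%N ->
  exists p' z' i x,
    [/\ p = rcons p' i, z = rcons z' x, homogeneous p' z' & part i x].
Proof.
elim: p z => [|i p IH] [|x z] //= [px hz] _.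
case: p IH hz => [|j p] IH hz.
  by case: z hz => // _; exists [::], [::], i, x.
have [p' [z' [k [y [-> -> hz' py]]]]] := IH _ hz isT.
by exists (i :: p'), (x :: z'), k, y.
Qed.

End Words.

Arguments word : simpl never.

(** * A word length whose span is stable under ad *)

Section StableWords.
Variables (F : fieldType) (L : finLieSuperalgType F).
Hypothesis L_simple : simple_lie_superalgebra L.

HB.instance Definition _ (z : seq L) :=
  GRing.isLinear.Build F L L *:%R (word z) (word_linear z).

Let ad (x : L) : 'End(L) := linfun (word [:: x]).

Let words (c : nat) : set 'End(L) := lspan [set f | exists p (z : seq L),
  [/\ homogeneous p z, size p = c & f = linfun (word z)]].

Let adE x u : ad x u = bracket x u.
Proof. by rewrite lfunE. Qed.

Let ad_linear (g : 'End(L)) a x y :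
  (ad (a *: x + y) \o g)%VF = a *: (ad x \o g)%VF + (ad y \o g)%VF.
Proof.
by apply/lfunP => u; rewrite !(comp_lfunE, add_lfunE, scale_lfunE, adE) bracketZDl.
Qed.

Let ad_comp c i x f : part i x -> words c f -> words c.+1 (ad x \o f)%VF.
Proof.
move=> px; have sW k : is_submodule (words k) := lspan_submodule _.
apply: (lspan_sub (V := [set f | words c.+1 (ad x \o f)%VF])).
  split=> /= [|a g h hg hh]; first by rewrite comp_lfun0r; exact: (sW c.+1).1.
  by rewrite comp_lfunDr -comp_lfunZr; apply: (sW c.+1).2.
move=> _ [p [z [hz <- ->]]]; apply: mem_lspan; exists (rcons p i), (rcons z x).
split; [exact: homogeneous_rcons|by rewrite size_rcons|].
by apply/lfunP => u; rewrite comp_lfunE adE !lfunE /= word_rcons.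
Qed.

(** By perfectness [x] is a combination of brackets of homogeneous elements, and the Jacobi identity
    turns [ad] of such a bracket into a supercommutator. *)
Let words1 x : words 2 (ad x).
Proof.
have sW k : is_submodule (words k) := lspan_submodule _.
suff : lspan (@homogeneous_brackets _ L) `<=` [set x | words 2 (ad x)].
  by apply; apply: simple_perfect.
have adlin a y w : ad (a *: y + w) = a *: ad y + ad w.
  by have := ad_linear \1%VF a y w; rewrite !comp_lfun1r.
apply: lspan_sub; first split=> [|a y w hy hw] /=.
- have -> : ad 0 = 0 by have := adlin (-1) 0 0; rewrite !scaleN1r oppr0 addr0 addNr.
  exact: (sW 2).1.
- by rewrite adlin; apply: (sW 2).2.
move=> _ [p [q [y [w [py qw ->]]]]] /=.
have wd i j a b : part i a -> part j b -> words 2 (ad a \o ad b)%VF.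
  move=> pa pb; apply: (ad_comp pa); apply: mem_lspan.
  by exists [:: j], [:: b].
have -> : ad (bracket y w) =
    (ad y \o ad w)%VF - (-1) ^+ (p && q) *: (ad w \o ad y)%VF.
  apply/lfunP => u.
  rewrite !(add_lfunE, opp_lfunE, scale_lfunE, comp_lfunE, adE).
  by rewrite (bracket_jacobi p q y w u py qw) addrK.
apply: submodB => //; first exact: wd py qw.
by apply: submodZ => //; apply: wd qw py.
Qed.

(** Induction from [words1]: peel off the letter acting last, lengthen the rest, and put the letter
    back with [ad_comp]. *)
Let words_incr c : words c.+1 `<=` words c.+2.
Proof.
have sW k : is_submodule (words k) := lspan_submodule _.
elim: c => [|c IH]; apply: lspan_sub => // _ [p [z [hz pz ->]]].
  case: p z hz pz => [|i [|j p]] [|x [|y z]] //= hz _; first exact: words1.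
  by case: hz.
have [|p' [z' [i [x [pE zE hz' px]]]]] := homogeneous_rconsE hz; first by rewrite pz.
have -> : linfun (word z) = (ad x \o linfun (word z'))%VF.
  by apply/lfunP => u; rewrite comp_lfunE adE !lfunE /= zE word_rcons.
apply: (ad_comp px); apply: IH; apply: mem_lspan; exists p', z'; split=> //.
by move: pz; rewrite pE size_rcons => -[].
Qed.

(** Length [C.+1] gives stability under ad; length 1 puts single brackets into the same span. *)
Definition stable_length (C : nat) : Prop :=
  forall p (z : seq L), homogeneous p z -> size p = 1%N \/ size p = C.+1 ->
  exists n (c : 'I_n -> F) (zs : 'I_n -> seq L),
    (forall i, exists p', homogeneous p' (zs i) /\ size p' = C) /\
    forall u, word z u = \sum_i c i *: word (zs i) u.

(* Since L = [L, L], the space spanned by the words of length c increases with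
   c >= 1, hence it is eventually constant. *)
Lemma stable_length_exists : exists2 C, (0 < C)%N & stable_length C.
Proof.
have /choice [K hK] : forall c, exists K : {vspace 'End(L)},
    forall f, words c f <-> f \in K.
  by move=> c; apply: submodule_vspace; apply: lspan_submodule.
have Kincr c : (K c.+1 <= K c.+2)%VS.
  by apply/subvP => f /hK hf; apply/hK; apply: words_incr.
have [C C0 KC] : exists2 C, (0 < C)%N & (K C.+1 <= K C)%VS.
  apply: contrapT => H.
  (* Otherwise each inclusion of [K c.+1] in [K c.+2] is strict and the dimensions outgrow that of
     End(L). *)
  have Klt c : (c <= \dim (K c.+1))%N.
    elim: c => // c IH; apply: leq_ltn_trans IH _.
    rewrite (ltn_leqif (dimv_leqif_sup (Kincr c))).
    by apply/negP => h; apply: H; exists c.+1.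
  have := leq_trans (Klt (\dim {:'End(L)}).+1) (dimvS (subvf _)).
  by rewrite ltnn.
have words1C c : words 1 `<=` words c.+1.
  by elim: c => // c IH f /IH; apply: words_incr.
exists C => // p z hz pz.
have : words C (linfun (word z)).
  have : words (size p) (linfun (word z)) by apply: mem_lspan; exists p, z.
  case: pz => ->; first by case: C C0 {KC} => // C _; apply: words1C.
  by move=> /hK /(subvP KC) /hK.
move=> [n [c [e [he zE]]]]; exists n, c.
have /choice [zs hzs] : forall i, exists zi : seq L,
    (exists p', homogeneous p' zi /\ size p' = C) /\ e i = linfun (word zi).
  by move=> i; have [p' [zi [? ? ->]]] := he i; exists zi; split=> //; exists p'.
exists zs; split=> [i|u]; first by have [] := hzs i.
have /lfunP/(_ u) := zE; rewrite lfunE sum_lfunE /= => ->.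
by apply: eq_bigr => i _; rewrite scale_lfunE (hzs i).2 lfunE.
Qed.

End StableWords.

(** * Selecting r coordinates with N at most r d^2 *)

Section Selection.
Variables (F : fieldType) (L : finLieSuperalgType F).
Hypothesis L_simple : simple_lie_superalgebra L.
Variables (C : nat) (C_stable : stable_length L C).
Variables (N : nat) (X : set {ffun 'I_N -> L}).
Hypothesis X_homogeneous : forall x, X x -> exists p, forall i, part p (x i).

(** The same word acts on all [N] coordinates at once. In [codim_mul] the set [X] holds the value
    vectors of [N] polynomials under common assignments. *)
Definition word_span : set {ffun 'I_N -> L} := lspan [set q | exists p z x,
  [/\ homogeneous p z, size p = C, X x & q = [ffun i => word z (x i)]]].

Let Q := word_span.
Let Q_submodule : is_submodule Q := lspan_submodule _.

Let Q_word p (z : seq L) (x : {ffun 'I_N -> L}) : homogeneous p z ->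
  size p = 1%N \/ size p = C.+1 -> X x -> Q [ffun i => word z (x i)].
Proof.
move=> hz pz Xx; have [n [c [zs [hzs zE]]]] := C_stable hz pz.
have -> : [ffun i => word z (x i)] =
    \sum_j c j *: [ffun i => word (zs j) (x i)].
  apply/ffunP => i; rewrite ffunE sum_ffunE zE.
  by apply: eq_bigr => j _; rewrite !ffunE.
apply: submod_sum => // j _; apply: submodZ => //; apply: mem_lspan.
by have [p' [? ?]] := hzs j; exists p', (zs j), x.
Qed.

(** Bracketing with [u] produces words of length [C.+1], which stability rewrites in length [C]. *)
Let Q_br p u (q : {ffun 'I_N -> L}) :
  part p u -> Q q -> Q [ffun i => bracket u (q i)].
Proof.
move=> pu.
suff : Q `<=` [set q : {ffun 'I_N -> L} | Q [ffun i => bracket u (q i)]] by apply.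
apply: lspan_sub.
  split=> [|a q1 q2 h1 h2] /=.
    rewrite (_ : [ffun _ => _] = 0); first exact: Q_submodule.1.
    by apply/ffunP => i; rewrite !ffunE br0r.
  have := Q_submodule.2 a _ _ h1 h2; congr Q.
  by apply/ffunP => i; rewrite !ffunE bracketZDr.
move=> _ [p' [z [x [hz pz Xx ->]]]] /=.
rewrite (_ : [ffun _ => _] = [ffun i => word (rcons z u) (x i)]).
  apply: Q_word Xx; first exact: homogeneous_rcons hz pu.
  by right; rewrite size_rcons pz.
by apply/ffunP => i; rewrite !ffunE word_rcons.
Qed.

Let Q_graded q : Q q -> exists q0 q1 : {ffun 'I_N -> L},
  [/\ Q q0, Q q1, forall i, part false (q0 i), forall i, part true (q1 i)
    & q = q0 + q1].
Proof.
apply: (@lspan_homogeneous _ _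
  (fun p => [set q : {ffun 'I_N -> L} | forall i, part p (q i)])).
  move=> p; split=> [i|a u v hu hv i]; rewrite !ffunE; first exact: part0.
  exact: partZD.
move=> _ [p [z [x [hz _ /X_homogeneous[i px] ->]]]].
exists (foldl addb i p) => j; rewrite ffunE; exact: word_part.
Qed.

(* S is maximal such that word_span projects onto L^S. For i outside S, the
   values at i of the elements of word_span that vanish on S form a proper
   graded ideal; hence word_span is the graph of an equivariant map on L^S. *)
Lemma word_span_selection :
  (forall t : 'rV[F]_N, (forall x, X x -> \sum_i t 0 i *: x i = 0) -> t = 0) ->
  exists r (s : 'I_r -> 'I_N), (N <= r * (\dim {:L} * \dim {:L}))%N /\
    forall u : 'I_r -> L, exists q, word_span q /\ forall i, q (s i) = u i.
Proof.
move=> X_free; pose gen (S : {set 'I_N}) :=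
  `[< forall u : {ffun 'I_N -> L}, exists q, Q q /\ {in S, q =1 u} >].
have gen0 : gen finset.set0.
  apply/asboolP => u; exists 0; split; first exact: Q_submodule.1.
  by move=> i; rewrite finset.in_set0.
case: (arg_maxnP (fun S : {set 'I_N} => #|S|) gen0) => S /asboolP genS Smax.
have Q0 q : Q q -> {in S, q =1 fun=> 0} -> q = 0.
  move=> Qq qS; apply/ffunP => i; rewrite ffunE.
  have [/qS //|iS] := boolP (i \in S).
  pose I := [set v | exists q, [/\ Q q, {in S, q =1 fun=> 0} & q i = v]].
  have : graded_ideal I.
    apply: graded_ideal_left.
    - split=> [|a _ _ [q1 [Qq1 q1S <-]] [q2 [Qq2 q2S <-]]].
        exists 0; split; [exact: Q_submodule.1| |by rewrite ffunE].
        by move=> j _; rewrite ffunE.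
      exists (a *: q1 + q2); split; rewrite ?ffunE //; first exact: Q_submodule.2.
      by move=> j jS; rewrite !ffunE q1S // q2S // scaler0 addr0.
    - move=> p z _ pz [q1 [Qq1 q1S <-]]; exists [ffun j => bracket z (q1 j)].
      split; rewrite ?ffunE //; first exact: Q_br pz Qq1.
      by move=> j jS; rewrite ffunE q1S // br0r.
    - move=> _ [q1 [/Q_graded[q2 [q3 [Qq2 Qq3 p2 p3 ->]]] qS1 <-]].
      have q23 j : j \in S -> q2 j = 0 /\ q3 j = 0.
        by move=> jS; apply: (part_add0 (p2 j) (p3 j)); have := qS1 _ jS; rewrite ffunE.
      exists (q2 i), (q3 i); split; rewrite ?ffunE //.
      + by exists q2; split=> // j /q23[].
      + by exists q3; split=> // j /q23[].
  move=> /(L_simple.2) [I0|IT].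
    by have : I (q i) by [exists q]; rewrite I0.
  (* If the ideal is all of L, the value at [i] can be corrected without changing those on [S],
     against the maximality of [S]. *)
  suff /Smax : gen (i |: S) by rewrite /= cardsU1 iS ltnn.
  apply/asboolP => u; have [q1 [Qq1 q1S]] := genS u.
  have [q2 [Qq2 q2S q2i]] : I (u i - q1 i) by rewrite IT.
  exists (q1 + q2); split; first exact: submodD.
  move=> j /setU1P[->|jS]; rewrite ffunE; first by rewrite q2i addrC subrK.
  by rewrite q1S // q2S // addr0.
have Qinj q q' : Q q -> Q q' -> {in S, q =1 q'} -> q = q'.
  move=> Qq Qq' qq'; apply/eqP; rewrite -subr_eq0; apply/eqP/Q0.
    exact: submodB.
  by move=> i iS; rewrite !ffunE qq' // subrr.
(* For [s] in [S], [B (s, v)] is the element of [Q] with value [v] at [s] and 0 on the rest of [S].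
   Its uniqueness ([Qinj]) makes it linear and ad-equivariant in [v]. *)
have /choice [B hB] : forall sv : 'I_N * L, exists q, Q q /\
    {in S, forall i, q i = if i == sv.1 then sv.2 else 0}.
  move=> [s v]; have [q [Qq qS]] := genS [ffun i => if i == s then v else 0].
  by exists q; split=> // i iS; rewrite qS // ffunE.
have QB s v : Q (B (s, v)) by case: (hB (s, v)).
have BS s v i : i \in S -> B (s, v) i = if i == s then v else 0.
  by case: (hB (s, v)) => _ /(_ i).
have Blin s i : linear (fun v => B (s, v) i).
  move=> a v w; suff -> : B (s, a *: v + w) = a *: B (s, v) + B (s, w).
    by rewrite !ffunE.
  apply: Qinj => // [|j jS]; first exact: Q_submodule.2.
  rewrite !ffunE !BS //; case: eqP => // _; by rewrite scaler0 addr0.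
have Bbr s p z v : part p z -> forall i,
    B (s, bracket z v) i = bracket z (B (s, v) i).
  move=> pz i; suff -> : B (s, bracket z v) = [ffun j => bracket z (B (s, v) j)].
    by rewrite ffunE.
  apply: Qinj => // [|j jS]; first exact: Q_br pz _.
  by rewrite !ffunE !BS //; case: eqP => // _; rewrite br0r.
have QE q i : Q q -> q i = \sum_(s in S) B (s, q s) i.
  move=> Qq; rewrite -sum_ffunE; congr (fun_of_fin _ i).
  apply: Qinj => // [|j jS]; first by apply: submod_sum.
  rewrite sum_ffunE (bigD1 j) //= BS // eqxx big1 ?addr0 // => s /andP[_ sj].
  by rewrite BS // eq_sym (negPf sj).
(* [x] itself need not lie in [Q], but its brackets do, by stability at length 1; so the two sides
   differ by a central element, which is zero. *)
have XE x i : X x -> x i = \sum_(s in S) B (s, x s) i.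
  move=> Xx; apply/eqP; rewrite -subr_eq0; apply/eqP.
  apply: (center_trivial L_simple) => p z pz; rewrite brBr br_sumr.
  have Qzx : Q [ffun j => bracket z (x j)].
    by apply: (@Q_word [:: p] [:: z]) => //; left.
  have := QE _ i Qzx; rewrite ffunE => ->.
  apply/eqP; rewrite subr_eq0; apply/eqP/eq_bigr => s _.
  by rewrite ffunE (Bbr _ _ _ _ pz).
have /choice [th hth] : forall si : 'I_N * 'I_N, exists f : 'End(L),
    forall v, f v = B (si.1, v) si.2.
  by move=> [s i]; have [f fE] := linear_lfun (Blin s i); exists f.
exists #|S|, (fun i => enum_val i); split; last first.
  move=> u; pose u' : {ffun 'I_N -> L} :=
    [ffun i => if [pick j | enum_val (A := mem S) j == i] is Some j then u j else 0].
  have [q [Qq qS]] := genS u'; exists q; split=> // i.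
  rewrite qS ?enum_valP // ffunE; case: pickP => [j /eqP/enum_val_inj -> //|].
  by move=> /(_ i); rewrite eqxx.
(* If these endomorphisms, one for each [s] in [S], all vanish, then by [XE] the combination of the
   [x i] with coefficients [t] vanishes on [X], so [t] is zero. Hence [N] is at most the dimension
   of the target. *)
pose g (t : 'rV[F]_N) : {ffun 'I_#|S| -> 'End(L)} :=
  [ffun j => \sum_i t 0 i *: th (enum_val j, i)].
have dimg : (\dim {:{ffun 'I_#|S| -> 'End(L)}} =
    #|S| * (\dim {:L} * \dim {:L}))%N.
  by rewrite !dimvf -[LHS]/(#|{: 'I_(#|S|)}| * (dim L * dim L))%N card_ord.
have dimN : N = \dim {:'rV[F]_N} by rewrite dimvf dim_matrix mul1r.
rewrite [leqLHS]dimN -dimg; apply: (@dim_le_injective _ _ _ g).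
  move=> a t t'; apply/ffunP => j; rewrite !ffunE scaler_sumr -big_split.
  by apply: eq_bigr => i _; rewrite !mxE scalerDl scalerA.
move=> t /ffunP gt; apply: X_free => x Xx.
under eq_bigr => i _ do rewrite (XE x i Xx) scaler_sumr.
rewrite exchange_big big1 //= => s sS.
have := gt (enum_rank_in sS s); rewrite !ffunE enum_rankK_in //.
move=> /lfunP/(_ (x s)); rewrite sum_lfunE lfunE /= => gs.
by rewrite -[RHS]gs; apply: eq_bigr => i _; rewrite scale_lfunE hth.
Qed.

End Selection.

(** * Renaming and adding variables in the free Lie superalgebra *)

Section Polynomials.
Variable F : fieldType.
Implicit Types (f g : freeLie F) (v : nat + nat) (m : mono).

Definition isodd v : bool := if v is inr _ then true else false.

Definition var v : freeLie F :=
  match v with inl i => lcls (Tx i) | inr j => lcls (Ty j) end.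

Definition shiftv (k l : nat) v : nat + nat :=
  match v with inl i => inl (k + i)%N | inr j => inr (l + j)%N end.

Definition nextv (b : bool) (k l : nat) : nat + nat :=
  if b then inr l else inl k.

(** Evaluation in the free Lie superalgebra itself, so that the homomorphism property comes from
    [leval]. It makes the variables of two factors disjoint. *)
Definition shift k l f : freeLie F :=
  leval (L := freeLie F) (fun i => var (inl (k + i)%N))
    (fun j => var (inr (l + j)%N)) f.

(** The polynomial counterpart of [word]: its letters are fresh variables of the parities in [p]. As
    numbers, [~~ b] and [b] count the even and odd variables added. *)
Fixpoint padw (p : seq bool) (k l : nat) f : freeLie F :=
  match p with
  | [::] => f
  | b :: p' => padw p' (k + ~~ b) (l + b) (bracket (var (nextv b k l)) f)
  end.

Lemma mem_mvars k l v :
  (v \in mvars k l) = match v with inl i => (i < k)%N | inr j => (j < l)%N end.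
Proof.
rewrite mem_cat; case: v => i; apply/orP/idP => [[]/mapP[j]|hi] //.
- by rewrite mem_iota => ? [->].
- by left; rewrite mem_map ?mem_iota // => ? ? [].
- by rewrite mem_iota => ? [->].
- by right; rewrite mem_map ?mem_iota // => ? ? [].
Qed.

Lemma mvars_uniq k l : uniq (mvars k l).
Proof.
rewrite cat_uniq !map_inj_uniq ?iota_uniq ?andbT /=; try by move=> ? ? [].
by apply/hasPn => _ /mapP[j _ ->]; apply/negP => /mapP[].
Qed.

Lemma perm_mvars_add k l k' l' :
  perm_eq (mvars k l ++ map (shiftv k l) (mvars k' l'))
    (mvars (k + k') (l + l')).
Proof.
have E c (h : nat -> nat + nat) (n n' : nat) :
    (forall i, shiftv k l (h i) = h (c + i)%N) ->
    map (shiftv k l) (map h (iota n n')) = map h (iota (c + n) n').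
  by move=> hc; rewrite iotaDl -!map_comp; apply: eq_map.
rewrite /mvars map_cat !iotaD !map_cat !add0n.
rewrite (E k inl) // (E l inr) // !addn0.
by rewrite perm_catACA.
Qed.

Lemma mpart_submodule k l : is_submodule (@mpart F k l).
Proof. exact: lspan_submodule. Qed.

Lemma mpart_sub k l (V : set (freeLie F)) : is_submodule V ->
  (forall m, multilinear k l m -> V (mono_val F m)) -> @mpart F k l `<=` V.
Proof.
by move=> hV hm; apply: lspan_sub => // _ [m /= ? <-]; apply: hm.
Qed.

Lemma mem_mpart k l m : multilinear k l m -> mpart k l (mono_val F m).
Proof. by move=> hm; apply: mem_lspan; exists m. Qed.

Lemma fpart_var v : part (isodd v) (var v).
Proof. by case: v => i; [exists (Tx i)|exists (Ty i)]; constructor. Qed.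

Lemma mpart_bracket_next (b : bool) k l f : mpart k l f ->
  mpart (k + ~~ b) (l + b) (bracket (var (nextv b k l)) f).
Proof.
have [P0 PZD] := mpart_submodule (k + ~~ b) (l + b).
have hV : is_submodule
    [set f | mpart (k + ~~ b) (l + b) (bracket (var (nextv b k l)) f)].
  split=> [|a g h hg hh] /=; first by rewrite br0r.
  by rewrite bracketZDr; apply: PZD.
move: f; apply: (mpart_sub hV) => m hm /=.
have -> : var (nextv b k l) = mono_val F (if b then My l else Mx k) by case: (b).
apply: (@mem_mpart _ _ (Mbr _ m)).
apply: perm_trans (perm_mvars_add k l _ _).
have -> : map (shiftv k l) (mvars (~~ b) b) = [:: nextv b k l].
  by case: (b) => /=; rewrite addn0.
have -> : leaves (Mbr (if b then My l else Mx k) m) = [:: nextv b k l] ++ leaves m.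
  by case: (b).
by rewrite perm_catC perm_cat2r.
Qed.

Lemma shift_var k l v : shift k l (var v) = var (shiftv k l v).
Proof.
by case: v => i; rewrite /shift /= leval_cls //= => j;
  (apply: (fpart_var (inl _)) || apply: (fpart_var (inr _))).
Qed.

Lemma shiftZD k l c f g :
  shift k l (c *: f + g) = c *: shift k l f + shift k l g.
Proof.
by apply: levalZD => j; [apply: (fpart_var (inl _))|apply: (fpart_var (inr _))].
Qed.

Lemma shift_bracket k l f g :
  shift k l (bracket f g) = bracket (shift k l f) (shift k l g).
Proof.
by apply: leval_bracket => j; [apply: (fpart_var (inl _))|apply: (fpart_var (inr _))].
Qed.

Fixpoint mono_shift k l m :=
  match m with
  | Mx i => Mx (k + i)
  | My j => My (l + j)
  | Mbr s t => Mbr (mono_shift k l s) (mono_shift k l t)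
  end.

Lemma leaves_shift k l m :
  leaves (mono_shift k l m) = map (shiftv k l) (leaves m).
Proof. by elim: m => //= s -> t ->; rewrite map_cat. Qed.

Lemma shift_mono k l m :
  shift k l (mono_val F m) = mono_val F (mono_shift k l m).
Proof.
elim: m => [i|j|s IHs t IHt] /=; last by rewrite shift_bracket IHs IHt.
- exact: (shift_var k l (inl i)).
- exact: (shift_var k l (inr j)).
Qed.

Lemma mpart_bracket k l k' l' f g : mpart k l f -> mpart k' l' g ->
  mpart (k + k') (l + l') (bracket f (shift k l g)).
Proof.
have [P0 PZD] := mpart_submodule (k + k') (l + l').
move=> hf; have hV : is_submodule
    [set g | mpart (k + k') (l + l') (bracket f (shift k l g))].
  split=> [|a g1 g2 h1 h2] /=.
    have -> : shift k l 0 = 0.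
      by have := shiftZD k l (-1) 0 0; rewrite !scaleN1r oppr0 addr0 addNr.
    by rewrite br0r.
  by rewrite shiftZD bracketZDr; apply: PZD.
move: g; apply: (mpart_sub hV) => m hm /=.
have hW : is_submodule
    [set f | mpart (k + k') (l + l') (bracket f (shift k l (mono_val F m)))].
  split=> [|a g1 g2 h1 h2] /=; first by rewrite br0l.
  by rewrite bracketZDl; apply: PZD.
move: f hf {hV}; apply: (mpart_sub hW) => m' hm' /=; rewrite shift_mono.
apply: (@mem_mpart _ _ (Mbr m' _)).
rewrite /multilinear /= leaves_shift.
by rewrite (perm_trans (perm_cat hm' (perm_map _ hm))) // perm_mvars_add.
Qed.

Lemma mpart_padw p k l f : mpart k l f ->
  mpart (k + count negb p) (l + count id p) (padw p k l f).
Proof.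
elim: p k l f => [|b p IH] k l f hf /=; first by rewrite !addn0.
by rewrite !addnA; apply: IH; apply: mpart_bracket_next.
Qed.

End Polynomials.

(** * Evaluation of multilinear polynomials on graded assignments *)

Section Update.
Variables (T : Type).
Implicit Types (e : nat + nat -> T) (v : nat + nat).

Definition upd e v (x : T) := fun w => if w == v then x else e w.

Lemma updE e v x : upd e v x v = x.
Proof. by rewrite /upd eqxx. Qed.

Lemma upd_neq e v x w : w != v -> upd e v x w = e w.
Proof. by rewrite /upd => /negPf ->. Qed.

End Update.

Section Assignments.
Variables (F : fieldType) (L : lieSuperalgType F).
Implicit Types (f g : freeLie F) (v : nat + nat) (m : mono) (e : nat + nat -> L).

Definition graded_assignment e : Prop := forall v, part (isodd v) (e v).

Definition ev e f : L := leval (e \o inl) (e \o inr) f.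

Fixpoint mono_ev e m : L :=
  match m with
  | Mx i => e (inl i)
  | My j => e (inr j)
  | Mbr s t => bracket (mono_ev e s) (mono_ev e t)
  end.

Lemma gradedIdP f :
  gradedId L f <-> forall e, graded_assignment e -> ev e f = 0.
Proof.
split=> [hf e he|hf a b ha hb].
  by apply: hf => i; [apply: (he (inl i))|apply: (he (inr i))].
pose e v := match v with inl i => a i | inr j => b j end.
by apply: (hf e); case=> i /=.
Qed.

Lemma upd_graded e v x :
  graded_assignment e -> part (isodd v) x -> graded_assignment (upd e v x).
Proof. by move=> he hx w; rewrite /upd; case: eqP => [->|_]. Qed.

Section Graded.
Variable e : nat + nat -> L.
Hypothesis he : graded_assignment e.

Lemma evZD c f g : ev e (c *: f + g) = c *: ev e f + ev e g.
Proof. by apply: levalZD => i; [apply: (he (inl i))|apply: (he (inr i))]. Qed.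

Lemma ev0 : ev e 0 = 0.
Proof. by have := evZD (-1) 0 0; rewrite !scaleN1r oppr0 addr0 addNr. Qed.

Lemma ev_sum (I : Type) (r : seq I) (c : I -> F) (f : I -> freeLie F) :
  ev e (\sum_(i <- r) c i *: f i) = \sum_(i <- r) c i *: ev e (f i).
Proof.
elim: r => [|i r IH]; first by rewrite !big_nil ev0.
by rewrite !big_cons evZD IH.
Qed.

Lemma ev_bracket f g : ev e (bracket f g) = bracket (ev e f) (ev e g).
Proof. by apply: leval_bracket => i; [apply: (he (inl i))|apply: (he (inr i))]. Qed.

Lemma ev_var v : ev e (var F v) = e v.
Proof.
by case: v => i; rewrite /ev leval_cls // => j;
  [apply: (he (inl j))|apply: (he (inr j))|apply: (he (inl j))|apply: (he (inr j))].
Qed.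

Lemma ev_mono m : ev e (mono_val F m) = mono_ev e m.
Proof.
elim: m => [i|j|s IHs t IHt] /=; last by rewrite ev_bracket IHs IHt.
- exact: (ev_var (inl i)).
- exact: (ev_var (inr j)).
Qed.

Lemma ev_part k l f : mpart k l f -> part (odd l) (ev e f).
Proof.
have hV : is_submodule [set f | part (odd l) (ev e f)].
  split=> [|a g h hg hh] /=; first by rewrite ev0; apply: part0.
  by rewrite evZD; apply: partZD.
move: f; apply: (mpart_sub hV) => m hm /=; rewrite ev_mono.
have -> : l = count isodd (leaves m).
  rewrite (permP hm) count_cat !count_map.
  rewrite (eq_count (a2 := xpred0)) // count_pred0 add0n.
  by rewrite (eq_count (a2 := predT)) // count_predT size_iota.
elim: m {hm} => [i|j|s IHs t IHt] /=; first exact: (he (inl i)).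
  exact: (he (inr j)).
by rewrite count_cat oddD; apply: bracket_part.
Qed.

End Graded.

Lemma ev_local k l f e e' : graded_assignment e -> graded_assignment e' ->
  mpart k l f -> {in mvars k l, e =1 e'} -> ev e f = ev e' f.
Proof.
move=> he he' hf ee'; move: f hf.
apply: (@mpart_sub _ _ _ [set f | ev e f = ev e' f]).
  by split=> [|a g h hg hh] /=; rewrite ?ev0 // !evZD // hg hh.
move=> m hm /=; rewrite !ev_mono //.
have {hm} : {in leaves m, e =1 e'} by move=> v; rewrite (perm_mem hm); apply: ee'.
elim: m => [i|j|s IHs t IHt] /= hm; try by apply: hm; rewrite inE.
by rewrite IHs ?IHt // => v hv; apply: hm; rewrite mem_cat hv ?orbT.
Qed.

Lemma mono_ev_upd e v x m :
  v \notin leaves m -> mono_ev (upd e v x) m = mono_ev e m.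
Proof.
elim: m => [i|j|s IHs t IHt] /=; try by rewrite inE eq_sym; apply: upd_neq.
by rewrite mem_cat negb_or => /andP[? ?]; rewrite IHs ?IHt.
Qed.

(** In a multilinear monomial [v] is a leaf exactly once, so at each bracket the update reaches only
    one factor. *)
Lemma ev_updZD k l f e v c x y : mpart k l f -> v \in mvars k l ->
  graded_assignment e -> part (isodd v) x -> part (isodd v) y ->
  ev (upd e v (c *: x + y)) f = c *: ev (upd e v x) f + ev (upd e v y) f.
Proof.
move=> hf hv he px py.
have hu z : part (isodd v) z -> graded_assignment (upd e v z) by apply: upd_graded.
have hxy := partZD _ c _ _ px py.
move: f hf; apply: (@mpart_sub _ _ _ [set f |
  ev (upd e v (c *: x + y)) f = c *: ev (upd e v x) f + ev (upd e v y) f]).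
  split=> [|a g h hg hh] /=.
    by rewrite !ev0 ?scaler0 ?addr0 //; apply: hu.
  rewrite !evZD ?hg ?hh; try exact: hu.
  by rewrite !scalerDr !scalerA [a * c]mulrC addrACA.
move=> m hm /=; rewrite !ev_mono; try exact: hu.
have : v \in leaves m by rewrite (perm_mem hm).
have : uniq (leaves m) by rewrite (perm_uniq hm) mvars_uniq.
elim: m {hm} => [i|j|s IHs t IHt] /=; try by rewrite inE => _ /eqP ->; rewrite !updE.
rewrite cat_uniq mem_cat => /and3P[us /hasPn st ut] /orP[vs|vt].
  have vt : v \notin leaves t by apply/negP => /st; rewrite /= vs.
  by rewrite IHs // !(mono_ev_upd _ _ vt) bracketZDl.
have vs := st _ vt; by rewrite IHt // !(mono_ev_upd _ _ vs) bracketZDr.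
Qed.

(** Both sides are homomorphisms in [f] that agree on the variables; [leval_unique] identifies
    them. *)
Lemma ev_shift k l f e : graded_assignment e ->
  ev e (shift k l f) = ev (e \o shiftv k l) f.
Proof.
move=> he; have he' : graded_assignment (e \o shiftv k l).
  by move=> v; have := he (shiftv k l v); case: v.
rewrite [RHS](_ : _ = (ev e \o shift k l) f) //; congr (_ f); apply/esym.
apply: leval_unique => /=.
- by move=> i; apply: (he' (inl i)).
- by move=> i; apply: (he' (inr i)).
- by move=> c g h; rewrite shiftZD evZD.
- by move=> g h; rewrite shift_bracket ev_bracket.
- by move=> i; rewrite -[lcls _]/(var F (inl i)) shift_var ev_var.
- by move=> i; rewrite -[lcls _]/(var F (inr i)) shift_var ev_var.
Qed.

(** The letters of [z] are assigned to fresh variables, which do not occur in [f]. One [e'] serves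
    all [f], so linear combinations can be evaluated. *)
Lemma padw_word p (z : seq L) k l e : homogeneous p z -> graded_assignment e ->
  exists e', graded_assignment e' /\
    forall f, mpart k l f -> ev e' (padw p k l f) = word z (ev e f).
Proof.
elim: p z k l e => [|b p IH] [|x z] k l e //=; first by exists e.
move=> [px hz] he; pose e1 := upd e (nextv b k l) x.
have he1 : graded_assignment e1 by apply: upd_graded => //; case: (b) px.
have [e' [he' e'E]] := IH z (k + ~~ b)%N (l + b)%N e1 hz he1.
exists e'; split=> // f hf; rewrite e'E; last exact: mpart_bracket_next.
rewrite ev_bracket // ev_var //.
have -> : e1 (nextv b k l) = x by apply: updE.
rewrite (ev_local he1 he hf) // => v hv; apply: upd_neq.
by apply: contraTneq hv => ->; rewrite mem_mvars; case: (b); rewrite /= ltnn.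
Qed.

(** After the shift the two factors share no variable, so the two assignments can be glued. *)
Lemma ev_bracket_shift k l k' l' e e' :
  graded_assignment e -> graded_assignment e' ->
  exists e'', graded_assignment e'' /\
    forall f g, mpart k l f -> mpart k' l' g ->
    ev e'' (bracket f (shift k l g)) = bracket (ev e f) (ev e' g).
Proof.
move=> he he'; pose e'' v := if v \in mvars k l then e v else
  e' (match v with inl i => inl (i - k)%N | inr j => inr (j - l)%N end).
have he'' : graded_assignment e''.
  move=> v; rewrite /e''; case: ifP => _; first exact: he.
  case: v => i /=; [exact: (he' (inl _))|exact: (he' (inr _))].
exists e''; split=> // f g hf hg; rewrite ev_bracket // ev_shift //; congr bracket.
  by apply: (ev_local he'' he hf) => v hv; rewrite /e'' hv.
congr (ev _ g); apply/funext => v; rewrite /e'' /= mem_mvars.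
by case: v => i /=; rewrite ltnNge leq_addr addKn.
Qed.

End Assignments.

(** * Binomial sums and parity patterns *)

Section BinomialSums.
Implicit Types (phi psi : nat -> nat -> nat).
Local Open Scope nat_scope.

(* The sum of 'C(n, k) * phi k l over k + l = n, by Pascal's rule. *)
Fixpoint bsum (n : nat) phi : nat :=
  if n is n'.+1
  then bsum n' (fun k l => phi k.+1 l) + bsum n' (fun k l => phi k l.+1)
  else phi 0 0.

Fixpoint patterns (n : nat) : seq (seq bool) :=
  if n is n'.+1
  then map (cons false) (patterns n') ++ map (cons true) (patterns n')
  else [:: [::]].

Lemma mem_patterns p n : (p \in patterns n) = (size p == n).
Proof.
elim: n p => [|n IH] [|b p] //=; first by rewrite mem_cat; apply/orP => -[] /mapP[].
rewrite eqSS -IH mem_cat; apply/orP/idP => [[]/mapP[q hq [_ ->]]|hp] //.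
by case: b; [right|left]; rewrite map_f.
Qed.

(** The weight ['C(n, k)] counts the patterns with [k] even letters; this gives the unweighted sum
    that [dim_le_sum_quot_dim] bounds with. *)
Lemma bsum_patterns n phi :
  bsum n phi = \sum_(p <- patterns n) phi (count negb p) (count id p).
Proof.
elim: n phi => [|n IH] phi /=; first by rewrite big_seq1.
by rewrite !IH big_cat !big_map.
Qed.

Lemma bsumE n phi : bsum n phi = \sum_(k < n.+1) 'C(n, k) * phi k (n - k).
Proof.
elim: n phi => [|n IH] phi; first by rewrite big_ord1 mul1n.
rewrite /= !IH [RHS]big_ord_recl bin0 mul1n subn0.
under [in RHS]eq_bigr do rewrite lift0 binS mulnDl subSS.
rewrite big_split /= addnA [RHS]addnC; congr (_ + _).
rewrite big_ord_recl bin0 mul1n subn0; congr (_ + _).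
rewrite [in RHS]big_ord_recr /= bin_small // mul0n addn0; apply: eq_bigr => k _.
by rewrite /bump /= add1n subnSK.
Qed.

Lemma leq_bsum n phi psi :
  (forall k l, phi k l <= psi k l) -> bsum n phi <= bsum n psi.
Proof.
by elim: n phi psi => [|n IH] phi psi h //=; rewrite leq_add ?IH.
Qed.

Lemma eq_bsum n phi psi : phi =2 psi -> bsum n phi = bsum n psi.
Proof.
by move=> h; elim: n phi psi h => [|n IH] phi psi h //=; congr (_ + _); apply: IH.
Qed.

Lemma bsumMl n c phi : bsum n (fun k l => c * phi k l) = c * bsum n phi.
Proof. by elim: n phi => [|n IH] phi //=; rewrite !IH mulnDr. Qed.

(** A weighted form of Vandermonde's identity. *)
Lemma bsum_add n m phi : bsum (n + m) phi =
  bsum n (fun k l => bsum m (fun k' l' => phi (k + k') (l + l'))).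
Proof. by elim: n phi => [|n IH] phi //=; rewrite !IH. Qed.

Lemma bsum_expn n a b : bsum n (fun k l => a ^ k * b ^ l) = (a + b) ^ n.
Proof.
elim: n => //= n IH; rewrite expnS mulnDl -IH -!bsumMl.
congr (_ + _); apply: eq_bsum => k l; first by rewrite expnS mulnA.
by rewrite expnS mulnCA.
Qed.

Lemma bsum_ge k l phi : phi k l <= bsum (k + l) phi.
Proof.
elim: k phi => [|k IH] phi; last first.
  by rewrite addSn /= (leq_trans (IH (fun k l => phi k.+1 l))) // leq_addr.
elim: l phi => // l IH phi.
by rewrite addnS /= (leq_trans (IH (fun k l => phi k l.+1))) // leq_addl.
Qed.

End BinomialSums.

(** * Upper, lower and supermultiplicative bounds on codimensions *)

Section CodimensionBounds.
Variables (F : fieldType) (L : finLieSuperalgType F).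
Implicit Types (f g : freeLie F) (e : nat + nat -> L).

Let d := \dim {:L}.

Lemma gr_codimE n : gr_codim L n = bsum n (codim L).
Proof. by rewrite bsumE. Qed.

Lemma mpart_gradedId_submodule k l :
  is_submodule (@mpart F k l `&` gradedId L).
Proof.
have [P0 PZD] := @mpart_submodule F k l.
have [I0 IZD] := gradedId_submodule L.
by split=> [|a u v [? ?] [? ?]]; split=> //; [apply: PZD|apply: IZD].
Qed.

(** Independence modulo the identities comes from the uniqueness of the coordinates of 0 in the
    quotient. *)
Lemma codim_basis k l : exists f : 'I_(codim L k l) -> freeLie F,
  (forall i, mpart k l (f i)) /\
  forall t : 'rV[F]_(codim L k l), gradedId L (\sum_i t 0 i *: f i) -> t = 0.
Proof.
have [f [fP hf]] := codimP L k l; have hP := @mpart_submodule F k l.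
have [I0 _] := gradedId_submodule L.
exists f; split=> // t ht; have [c [_ uc]] := hf 0 hP.1.
have /uc tc : (mpart k l `&` gradedId L) (0 - \sum_i (- t) 0 i *: f i).
  under eq_bigr do rewrite mxE scaleNr.
  rewrite sumrN opprK add0r; split=> //.
  by apply: submod_sum => // i _; apply: submodZ.
apply: oppr_inj; rewrite oppr0 -tc; apply/uc.
by rewrite big1 ?subr0 => [|i _]; rewrite ?mxE ?scale0r //; split=> //; exact: hP.1.
Qed.

Lemma codim_gt0 k l f : mpart k l f -> ~ gradedId L f -> (0 < codim L k l)%N.
Proof.
move=> hf nf; rewrite lt0n; apply/eqP => c0; apply: nf.
have := codimP L k l; rewrite c0 => -[e [_ /(_ _ hf)[c [[_ hc] _]]]].
by move: hc; rewrite big_ord0 subr0.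
Qed.

Lemma graded_dims : exists b : bool -> nat, (b false + b true <= d)%N /\
  exists B : forall p, 'I_(b p) -> L, (forall p i, part p (B p i)) /\
  forall p u, part p u -> exists c : 'I_(b p) -> F, u = \sum_i c i *: B p i.
Proof.
have /choice [K hK] : forall p, exists K : {vspace L}, forall u, part p u <-> u \in K.
  by move=> p; apply: submodule_vspace; apply: part_submodule.
exists (fun p => \dim (K p)); split.
  rewrite -dimv_disjoint_sum ?dimvS ?subvf //.
  apply/eqP; rewrite -subv0; apply/subvP => u.
  rewrite memv_cap => /andP[/hK u0 /hK u1].
  by rewrite memv0; apply/eqP; apply: part_direct.
exists (fun p i => (vbasis (K p))`_i); split=> [p i|p u /hK uK].
  by apply/hK/vbasis_mem/mem_nth; rewrite size_tuple.
by exists (fun i => coord (vbasis (K p)) i u); apply: coord_vbasis.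
Qed.

(** A multilinear polynomial vanishing on all tuples of basis vectors is an identity, so coefficient
    rows embed into the functions from such tuples to L. *)
Lemma codim_le (b : bool -> nat) (B : forall p, 'I_(b p) -> L) k l :
  (forall p i, part p (B p i)) ->
  (forall p u, part p u -> exists c : 'I_(b p) -> F, u = \sum_i c i *: B p i) ->
  (codim L k l <= d * (b false ^ k * b true ^ l))%N.
Proof.
move=> partB spanB; have [f [fP f_free]] := codim_basis k l.
pose I : finType := ({ffun 'I_k -> 'I_(b false)} * {ffun 'I_l -> 'I_(b true)})%type.
pose a (x : I) (v : nat + nat) : L := match v with
  | inl i => if insub i is Some i' then B false (x.1 i') else 0
  | inr j => if insub j is Some j' then B true (x.2 j') else 0 end.
have ha x : graded_assignment (a x).
  by case=> i /=; case: insubP => [i' _ _|_] //; apply: part0.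
pose g (t : 'rV[F]_(codim L k l)) : {ffun I -> L} :=
  [ffun x => ev (a x) (\sum_i t 0 i *: f i)].
have dimI : (\dim {:{ffun I -> L}} = d * (b false ^ k * b true ^ l))%N.
  rewrite /d !dimvf -[LHS]/(#|{: I}| * dim L)%N mulnC.
  by rewrite card_prod !card_ffun !card_ord.
have dimt : codim L k l = \dim {:'rV[F]_(codim L k l)}.
  by rewrite dimvf dim_matrix mul1r.
rewrite [leqLHS]dimt -dimI; apply: (@dim_le_injective _ _ _ g).
  move=> c t t'; apply/ffunP => x; rewrite !ffunE -evZD; last exact: ha.
  congr (ev _ _); rewrite scaler_sumr -big_split; apply: eq_bigr => i _.
  by rewrite !mxE scalerDl scalerA.
move=> t /ffunP gt; apply: f_free; set h := \sum_i _ in gt *.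
have hP : mpart k l h.
  apply: submod_sum => [|i _]; first exact: mpart_submodule.
  by apply: submodZ; first exact: mpart_submodule.
apply/gradedIdP => e he.
(* [vs] lists the variables whose values may still be arbitrary; the induction removes one by
   expanding its value in the basis. *)
suff H (vs : seq (nat + nat)) e' : graded_assignment e' ->
    (forall v, v \in mvars k l -> v \notin vs ->
      exists i, e' v = B (isodd v) i) -> ev e' h = 0.
  by apply: (H (mvars k l)) => // v ->.
elim: vs e' {e he} => [|v vs IH] e he eB.
  have /choice [x1 hx1] : forall i : 'I_k, exists j, e (inl (val i)) = B false j.
    by move=> i; apply: (eB (inl (val i))) => //; rewrite mem_mvars ltn_ord.
  have /choice [x2 hx2] : forall i : 'I_l, exists j, e (inr (val i)) = B true j.
    by move=> i; apply: (eB (inr (val i))) => //; rewrite mem_mvars ltn_ord.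
  have := gt (finfun x1, finfun x2); rewrite !ffunE => <-.
  apply: (ev_local he (ha _) hP) => -[i|i]; rewrite mem_mvars => hi /=.
    by rewrite insubT /= ffunE -hx1.
  by rewrite insubT /= ffunE -hx2.
have [vP|vP] := boolP (v \in mvars k l); last first.
  apply: IH => // w wP wvs; apply: eB => //; rewrite inE negb_or wvs andbT.
  by apply: contraNneq vP => <-.
have -> : e = upd e v (e v).
  by apply/funext => w; rewrite /upd; case: eqP => [->|].
have [c ->] := spanB _ _ (he v).
pose V := [set x | part (isodd v) x /\ ev (upd e v x) h = 0].
have hV : is_submodule V.
  split=> [|c' x y [px hx] [py hy]].
    split; first exact: part0.
    have := ev_updZD (-1) hP vP he (part0 _) (part0 _).
    by rewrite !scaleN1r oppr0 addr0 addNr.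
  split; first exact: partZD.
  by rewrite (ev_updZD _ hP vP he px py) hx hy scaler0 addr0.
suff [] : V (\sum_i c i *: B (isodd v) i) by [].
apply: submod_sum => // i _; apply: submodZ => //; split; first exact: partB.
apply: IH => [|w wP wvs]; first exact: upd_graded.
have [->|wv] := eqVneq w v; first by exists i; rewrite updE.
by rewrite upd_neq //; apply: eB => //; rewrite inE negb_or wv.
Qed.

Lemma gr_codim_le n : (gr_codim L n <= d * d ^ n)%N.
Proof.
have [b [bd [B [partB spanB]]]] := graded_dims.
rewrite gr_codimE.
apply: leq_trans (leq_bsum _ (fun k l => codim_le k l partB spanB)) _.
rewrite bsumMl bsum_expn leq_mul2l; apply/orP; right.
by case: n => // n; rewrite leq_exp2r.
Qed.

Hypothesis L_simple : simple_lie_superalgebra L.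

(** As the center is trivial, a nonzero value has a nonzero bracket with some homogeneous letter. *)
Lemma nonzero_word n : exists b p (u : L) z,
  [/\ part b u, homogeneous p z, size p = n & word z u <> 0].
Proof.
elim: n => [|n [b [p [u [z [pu hz <- zu]]]]]].
  have [x [y xy]] := L_simple.1; have [y0 [y1 [p0 p1 yE]]] := part_decomp y.
  have [y00|] := eqVneq y0 0; last first.
    by move=> /eqP y0n; exists false, [::], y0, [::].
  exists true, [::], y1, [::]; split=> // y10.
  apply: xy; rewrite yE y00.
  by move: y10; rewrite /word /= => ->; rewrite addr0 br0r.
have [i [x [px xz]]] : exists i (x : L), part i x /\ bracket x (word z u) <> 0.
  apply: contrapT => H; apply: zu; apply: (center_trivial L_simple) => i x px.
  by apply: contrapT => nx; apply: H; exists i, x.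
exists b, (rcons p i), u, (rcons z x); split=> //.
- exact: homogeneous_rcons.
- by rewrite size_rcons.
- by rewrite word_rcons.
Qed.

(** A nonzero word with [n - 1] letters, applied to [u], is a value of a multilinear polynomial in
    [n] variables, which is thus no identity. *)
Lemma gr_codim_gt0 n : (0 < n)%N -> (0 < gr_codim L n)%N.
Proof.
case: n => // n _; have [b [p [u [z [pu hz pn zu]]]]] := nonzero_word n.
pose e := upd (fun=> 0) (nextv b 0 0) u.
have he : graded_assignment e.
  by apply: upd_graded => [v|]; [exact: part0|case: (b) pu].
have hb : mpart (~~ b) b (var F (nextv b 0 0)).
  by case: (b); [exact: (@mem_mpart F 0 1 (My 0))|exact: (@mem_mpart F 1 0 (Mx 0))].
have [e' [he' e'E]] := padw_word (~~ b) b hz he.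
have zuE : ev e' (padw p (~~ b) b (var F (nextv b 0 0))) = word z u.
  by rewrite e'E // ev_var // /e updE.
have : (0 < codim L (~~ b + count negb p) (b + count id p))%N.
  apply: (codim_gt0 (mpart_padw p hb)) => /gradedIdP /(_ e' he') h0.
  by apply: zu; rewrite -zuE.
move=> /leq_trans; apply; rewrite gr_codimE.
have -> : n.+1 = (~~ b + count negb p + (b + count id p))%N.
  rewrite addnACA; have -> : (~~ b + b = 1)%N by case: (b).
  by rewrite add1n addnC -pn -(count_predC id p).
exact: bsum_ge.
Qed.

Lemma codim_mul C k l k' l' : stable_length L C ->
  (codim L k l * codim L k' l' <= d * d *
     bsum C (fun a b => codim L (k + (k' + a)) (l + (l' + b))))%N.
Proof.
move=> C_stable; have [f [fP f_free]] := codim_basis k l.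
have [g [gP g_free]] := codim_basis k' l'.
pose X : set {ffun 'I_(codim L k l) -> L} := [set x | exists e,
  graded_assignment e /\ x = [ffun i => ev e (f i)]].
have X_homogeneous x : X x -> exists p, forall i, part p (x i).
  move=> [e [he ->]]; exists (odd l) => i; rewrite ffunE; apply: (ev_part he (fP i)).
have [t ht|r [s [hr hs]]] := @word_span_selection _ _ L_simple _ C_stable _ _ X_homogeneous.
  apply: f_free; apply/gradedIdP => e he; rewrite ev_sum //.
  rewrite -[RHS](ht [ffun i => ev e (f i)]); last by exists e.
  by apply: eq_bigr => i _; rewrite ffunE.
(* It remains to bound the dimension of the space of [r] by [codim L k' l'] matrices. *)
apply: leq_trans (leq_mul hr (leqnn _)) _.
rewrite mulnAC mulnC leq_mul2l; apply/orP; right.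
have -> : (r * codim L k' l')%N = \dim {:'M[F]_(r, codim L k' l')}.
  by rewrite dimvf dim_matrix.
rewrite bsum_patterns.
pose mk p := (k + (k' + count negb p))%N; pose ml p := (l + (l' + count id p))%N.
(* This is [[z(f_(s i)), g_j]] with letters of parities [p] in [z] and [g_j] shifted past all
   variables of [z(f_(s i))]. *)
pose h p i j := bracket (padw p k l (f (s i)))
  (shift (k + count negb p) (l + count id p) (g j)).
apply: (@dim_le_sum_quot_dim _ _ _ _ (fun p => mpart (mk p) (ml p))
  (fun p => mpart (mk p) (ml p) `&` gradedId L) _ _
  (fun p (t : 'M[F]_(r, codim L k' l')) => \sum_i \sum_j t i j *: h p i j)).
- by move=> p; apply: mpart_gradedId_submodule.
- by move=> p; apply: codimP.
- move=> p c t t'; rewrite scaler_sumr -big_split; apply: eq_bigr => i _.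
  rewrite scaler_sumr -big_split; apply: eq_bigr => j _.
  by rewrite !mxE scalerDl scalerA.
- move=> p _ t; have hV := @mpart_submodule F (mk p) (ml p).
  apply: submod_sum => // i _; apply: submod_sum => // j _; apply: submodZ => //.
  rewrite /mk /ml !addnA ![(k + k' + _)%N]addnAC ![(l + l' + _)%N]addnAC.
  by apply: mpart_bracket => //; apply: mpart_padw.
move=> t ht.
(* The relations for all patterns [p] of length [C] hold on the values of words and extend by
   linearity to all of [word_span]. *)
have key q e' : word_span C X q -> graded_assignment e' ->
    \sum_i \sum_j t i j *: bracket (q (s i)) (ev e' (g j)) = 0.
  move=> Qq he'; pose E (q : {ffun 'I_(codim L k l) -> L}) :=
    \sum_i \sum_j t i j *: bracket (q (s i)) (ev e' (g j)).
  have Elin c q1 q2 : E (c *: q1 + q2) = c *: E q1 + E q2.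
    rewrite scaler_sumr -big_split; apply: eq_bigr => i _.
    rewrite scaler_sumr -big_split; apply: eq_bigr => j _.
    by rewrite !ffunE bracketZDl scalerDr !scalerA mulrC.
  suff : word_span C X `<=` [set q | E q = 0] by apply.
  apply: lspan_sub.
    split=> [|c q1 q2 /= h1 h2]; last by rewrite /= Elin h1 h2 scaler0 addr0.
    by have := Elin (-1) 0 0; rewrite !scaleN1r oppr0 addr0 addNr.
  move=> _ [p [z [_ [hz pC [e [he ->]] ->]]]] /=.
  have [e1 [he1 e1E]] := padw_word k l hz he.
  have [e2 [he2 e2E]] := ev_bracket_shift (k + count negb p) (l + count id p)
    k' l' he1 he'.
  have [_ /gradedIdP/(_ e2 he2)] := ht p (etrans (mem_patterns p C) (introT eqP pC)).
  move=> h0; rewrite -[RHS]h0.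
  have evD := fun c (f1 f2 : freeLie F) => evZD he2 c f1 f2.
  rewrite (big_morph (ev e2) (id1 := 0) (op1 := +%R)) => [|f1 f2|]; last 2 first.
  - by have := evD 1 f1 f2; rewrite !scale1r.
  - exact: ev0.
  apply: eq_bigr => i _; rewrite ev_sum //; apply: eq_bigr => j _.
  by rewrite e2E // ?e1E // ?ffunE //; apply: mpart_padw.
apply/row_matrixP => i0; rewrite row0; apply: g_free.
apply/gradedIdP => e he; apply: (center_trivial L_simple) => p z pz.
(* This [q] isolates row [i0]: the relation becomes the vanishing of the bracket of [z] with the
   value of the combination of the [g_j]. *)
have [q [Qq qE]] := hs (fun i => if i == i0 then z else 0).
rewrite -[RHS](key q e Qq he) (bigD1 i0) //= [X in _ = _ + X]big1 ?addr0.
  rewrite ev_sum // br_sumr; apply: eq_bigr => j _.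
  by rewrite mxE brZr qE eqxx.
move=> i /negPf ii0; rewrite big1 // => j _; by rewrite qE ii0 br0l scaler0.
Qed.

(** By [bsum_add] both sides are double sums over the types [(k, l)] and [(k', l')], compared term
    by term. *)
Lemma gr_codim_mul C n m : stable_length L C ->
  (gr_codim L n * gr_codim L m <= d * d * gr_codim L (n + m + C))%N.
Proof.
move=> C_stable; rewrite !gr_codimE -addnA bsum_add.
rewrite [leqLHS]mulnC -[leqLHS]bsumMl -[leqRHS]bsumMl; apply: leq_bsum => k l.
rewrite [leqLHS]mulnC -[leqLHS]bsumMl bsum_add -[leqRHS]bsumMl.
by apply: leq_bsum => k' l'; apply: codim_mul.
Qed.

End CodimensionBounds.

(** * Fekete's lemma and convergence of the roots *)

Section Fekete.
Variable R : realType.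

(** Each of the [q] copies of [s m] uses up [m + C] of the argument. *)
Lemma superadditive_iter (s : nat -> R) (C m n q : nat) :
  (0 < m)%N -> (0 < n)%N ->
  (forall i j, (0 < i)%N -> (0 < j)%N -> s i + s j <= s (i + j + C)%N) ->
  q%:R * s m + s n <= s (q * (m + C) + n)%N.
Proof.
move=> m0 n0 sD; elim: q => [|q IH]; first by rewrite mul0r add0r.
have -> : (q.+1 * (m + C) + n = m + (q * (m + C) + n) + C)%N.
  by rewrite mulSn -!addnA [(C + _)%N]addnC !addnA.
apply: le_trans (sD _ _ m0 _); last by rewrite addn_gt0 n0 orbT.
by rewrite -natr1 mulrDl mul1r addrAC addrC lerD2l.
Qed.

(* Fekete's lemma for the function n |-> s (n - C). *)
Lemma superadditive_cvg (s : nat -> R) (C : nat) (B M : R) :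
  (forall i j, (0 < i)%N -> (0 < j)%N -> s i + s j <= s (i + j + C)%N) ->
  (forall n, (0 < n)%N -> s n <= B * (n + C)%:R) ->
  (forall n, (0 < n)%N -> - M <= s n) ->
  exists2 l, l <= B & (fun n => s n / (n + C)%:R) @ \oo --> l.
Proof.
move=> sD sB sM; pose r n := s n / (n + C)%:R.
have nC0 n : (0 < n)%N -> 0 < (n + C)%:R :> R.
  by move=> n0; rewrite ltr0n addn_gt0 n0.
have rB n : (0 < n)%N -> r n <= B by move=> n0; rewrite ler_pdivrMr ?nC0 ?sB.
pose E := [set r n | n in [set n | (0 < n)%N]].
have E0 : E !=set0 by exists (r 1%N), 1%N.
have EB : ubound E B by move=> _ [n n0 <-]; apply: rB.
have Esup : has_sup E by split=> //; exists B.
exists (sup E); first exact: ge_sup.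
apply/cvgrPdist_le => eps eps0.
have [_ [m /= m0 <-] rm] := sup_adherent (divr_gt0 eps0 (@ltr0n R 2)) Esup.
(* [K] bounds [r m * (n0' + C) - s n0'] for every remainder [n0'] below, independently of [n]. *)
pose K := `|r m| * (m + C + C)%:R + M.
have rK n : (0 < n)%N -> r m - K / (n + C)%:R <= r n.
  move=> n0; rewrite ler_pdivlMr ?nC0 // mulrBl divfK ?gt_eqF ?nC0 //.
  (* Dividing [n.-1] instead of [n] keeps the remainder [n0'] between 1 and [m + C], hence
     positive. *)
  pose q := (n.-1 %/ (m + C))%N; pose n0' := (n.-1 %% (m + C)).+1.
  have nE : (n = q * (m + C) + n0')%N by rewrite addnS -divn_eq prednK.
  have n0'le : (n0' <= m + C)%N by rewrite ltn_pmod // addn_gt0 m0.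
  have := superadditive_iter q m0 (ltn0Sn _ : 0 < n0')%N sD; rewrite -nE.
  have sn0' := sM n0' isT; apply: le_trans.
  have -> : s m = r m * (m + C)%:R by rewrite divfK // gt_eqF ?nC0.
  have h : r m * (n0' + C)%:R <= `|r m| * (m + C + C)%:R.
    apply: le_trans (ler_norm _) _; rewrite normrM ler_wpM2l //.
    by rewrite ger0_norm ?ler0n // ler_nat leq_add2r.
  by rewrite {1}nE /K; move: h; rewrite !natrD !natrM !natrD => h; lra.
near=> n.
have n0 : (0 < n)%N by near: n; exists 1%N.
have rn : r n <= sup E by apply: ub_le_sup => //; [exists B|exists n].
rewrite ger0_norm ?subr_ge0 //.
have hK : K / (n + C)%:R <= eps / 2.
  rewrite ler_pdivrMr ?nC0 // mulrC -ler_pdivrMr ?divr_gt0 //.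
  apply: (@le_trans _ _ n%:R); last by rewrite ler_nat leq_addr.
  by near: n; apply: nbhs_infty_ger.
have := rK n n0; move: rm rn hK; rewrite -/(r n).
set x := K / _; set y := eps / 2; have -> : eps = y + y by rewrite /y; field.
by move=> *; lra.
Unshelve. all: by end_near.
Qed.

Lemma root_cvg (c : nat -> nat) (C d D : nat) : (0 < C)%N ->
  (forall n, (0 < n)%N -> (0 < c n)%N) ->
  (forall n, (c n <= d * d ^ n)%N) ->
  (forall n m, (c n * c m <= D * c (n + m + C))%N) ->
  let u n := ((c n)%:R : R) `^ (n%:R^-1) in cvgn u /\ limn u <= d%:R.
Proof.
move=> C0 c0 cd cD u.
have d0 : (0 < d)%N by have := leq_trans (c0 1%N isT) (cd 1%N); case: (d).
have D0 : (0 < D)%N.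
  have := leq_trans (_ : 0 < c 1 * c 1)%N (cD 1%N 1%N); case: (D) => //.
  by rewrite mul0n; apply; rewrite muln_gt0 !c0.
have pos n : (0 < n)%N -> (n%:R : R) \is Num.pos by rewrite posrE ltr0n.
(* Subtracting [ln D] absorbs the factor [D]: it occurs twice in [s i + s j] and once in
   [s (i + j + C)]. *)
pose s n : R := ln (c n)%:R - ln D%:R.
have lnD0 : 0 <= ln D%:R :> R by rewrite ln_ge0 // ler1n.
have [||n n0|l lB rl] := @superadditive_cvg s C (ln d%:R) (ln D%:R).
- move=> i j i0 j0; rewrite /s.
  have ij0 : (0 < i + j + C)%N by rewrite addn_gt0 C0 orbT.
  have : ln ((c i * c j)%:R : R) <= ln ((D * c (i + j + C))%:R : R).
    rewrite ler_ln ?ler_nat ?cD //; apply: pos; first by rewrite muln_gt0 !c0.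
    by rewrite muln_gt0 D0 c0.
  by rewrite !natrM !lnM ?pos ?c0 // => h; lra.
- move=> n n0; rewrite /s.
  have : ln ((c n)%:R : R) <= ln ((d ^ n.+1)%:R : R).
    by rewrite ler_ln ?ler_nat ?expnS ?cd //; apply: pos; rewrite ?c0 // -expnS expn_gt0 d0.
  rewrite natrX lnXn ?ltr0n // -mulr_natr => h.
  (* The extra factor [d] in [d * d ^ n] fits because [C] is positive. *)
  have : ln d%:R * (n.+1)%:R <= ln d%:R * (n + C)%:R :> R.
    by rewrite ler_wpM2l ?ln_ge0 ?ler1n // ler_nat -addn1 leq_add2l.
  by move=> ?; lra.
- by rewrite /s lerBrDr addrC subrr ln_ge0 // ler1n c0.
(* For positive [n] this equals [ln (c n) / n], written so that its limit follows from that of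
   [s n / (n + C)]. *)
pose t n := s n / (n + C)%:R + (s n / (n + C)%:R * C%:R + ln D%:R) * n%:R^-1.
have inv0 : (fun n => (n%:R^-1 : R)) @ \oo --> (0 : R).
  by rewrite -cvg_shiftS; apply: cvg_harmonic.
have tl : t @ \oo --> l.
  rewrite -[l]addr0 -[X in _ + X](mulr0 (l * C%:R + ln D%:R)).
  apply: cvgD => //; apply: cvgM => //; apply: cvgD; last exact: cvg_cst.
  by apply: cvgM => //; apply: cvg_cst.
have ul : u @ \oo --> expR l.
  have : expR \o t @ \oo --> expR l.
    by apply: continuous_cvg => //; apply: continuous_expR.
  apply: cvg_trans; apply: near_eq_cvg; near=> n.
  have n0 : (0 < n)%N by near: n; exists 1%N.
  rewrite /u /powR pnatr_eq0 gtn_eqF ?c0 //=; congr expR.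
  rewrite /t /s natrD; field.
  by rewrite -natrD !pnatr_eq0 -!lt0n n0 addn_gt0 n0.
split; first by apply/cvg_ex; exists (expR l).
rewrite (cvg_lim _ ul) //.
by rewrite -[leRHS]lnK ?pos // ler_expR.
Unshelve. all: by end_near.
Qed.

End Fekete.

Theorem theorem3p3 (R : realType) (F : fieldType) (L : finLieSuperalgType F) :
  [pchar F] =i pred0 ->
  simple_lie_superalgebra L ->
  cvgn (root_codim R L) /\ exp_gr R L <= (\dim {:L})%:R.
Proof.
move=> _ L_simple; have [C C0 C_stable] := stable_length_exists L_simple.
apply: (root_cvg R C0) => [n|n|n m].
- exact: gr_codim_gt0.
- exact: gr_codim_le.
- exact: gr_codim_mul.
Qed.
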